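(* Let $f:\mathbb{R}^m\to\mathbb{R}$, $\mathcal{F}$, $x_0$, $q\in(0,1]$, $L_1,L_2>0$ satisfy Assumption A in the context, let $\{x_k\}$ be generated by Algorithm 1 described in the context, and let $\overline{x}$ be an accumulation point of $\{x_k\}$, provided that the set $\mathcal{L}(f(x_{k_0}))=\{y:f(y)\le f(x_{k_0})\}$ is bounded for some $k_0\in\mathbb{N}$. Let $\Theta=\{x:\nabla f(x)=0,\ \nabla^2f(x)\succeq0\}$. Suppose that there exists $\eta>0$ such that $$\psi(d(x,\Theta))\le\|\nabla f(x)\|\quad\text{for all } x \text{ with } \|x-\overline{x}\|<\eta,$$ where $\psi:\mathbb{R}_+\to\mathbb{R}_+$ is an increasing admissible function. Define $\tau:\mathbb{R}_+\to\mathbb{R}_+$ by $$\tau(t):=\psi^{-1}\Big(\frac{3(1+\gamma L_1)L_2\ell^{q+1}}{q+1}\,t^{q+1}\Big),\quad t\in\mathbb{R}_+,$$ where $\ell$ is the unique positive solution $t$ of the equation $\overline{\sigma}t^{q+1}-2\overline{\sigma}t^q-L_2(q+1)t-L_2=0$, and $$\gamma:=\frac{1}{1-\zeta}\left[\frac{2(q+1)(q+2)}{(q+2)\overline{\sigma}-2L_2}(f(x_0)-f^* )\right]^{\frac{1}{q+2}}.$$ If $\limsup_{t\to0^+}\frac{\tau(t)}{t}<1$, then $\overline{x}\in\Theta$ and the sequence $\{x_k\}$ converges to $\overline{x}$ as $k\to\infty$ with the convergence rate $$\limsup_{k\to\infty}\frac{\|x_k-\overline{x}\|}{\tau(\|x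_{k-1}-\overline{x}\|)}<\infty.$$
   Context: $\mathbb{R}_+=[0,\infty)$, $\mathbb{N}=\{0,1,\ldots\}$; $d(x,S)$ is the Euclidean distance. A function $\psi:\mathbb{R}_+\to\mathbb{R}_+$ is admissible if $\psi(0)=0$ and $\psi(t)\to0$ implies $t\to0$. Assumption A. (1) $f$ is $C^2$-smooth and $f^*:=\inf_{x\in\mathbb{R}^m}f(x)>-\infty$. (2) There is a closed convex set $\mathcal{F}\subset\mathbb{R}^m$ with nonempty interior such that $\{y:f(y)\le f(x_0)\}\subset\mathrm{int}(\mathcal{F})$, where $x_0\in\mathrm{int}(\mathcal{F})$ is the starting point. (3) $\nabla f$ is Lipschitz continuous with modulus $L_1>0$ on $\mathcal{F}$, and $\|\nabla^2f(x)-\nabla^2f(y)\|\le L_2\|x-y\|^q$ for all $x,y\in\mathcal{F}$, with $L_2>0$ and $q\in(0,1]$. For $\sigma>0$ let $f_\sigma(y;x):=f(x)+\langle\nabla f(x),y-x\rangle+\frac12\langle\nabla^2f(x)(y-x),y-x\rangle+\frac{\sigma}{(q+1)(q+2)}\|y-x\|^{q+2}$. Algorithm 1. Input: $x_0=\widehat x_0\in\mathbb{R}^m$, scalars $\overline{\sigma}\in\left(\frac{2L_2}{q+2},L_2\right]$ and $\zeta\in[0,1)$. For $k=0,1,\ldots$: (a) choose $\sigma_k\in[\overline{\sigma},2L_2]$ and find $\widehat x_{k+1}\in\arg\min_{y\in\mathbb{R}^m}f_{\sigma_k}(y;x_k)$; (b) set $\beta_{k+1}=\min\{\zeta,\|\nabla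 f(\widehat x_{k+1})\|,\|\widehat x_{k+1}-x_k\|\}$ and $\widetilde x_{k+1}=\widehat x_{k+1}+\beta_{k+1}(\widehat x_{k+1}-\widehat x_k)$; (c) let $x_{k+1}$ be a minimizer of $f$ over the two-point set $\{\widehat x_{k+1},\widetilde x_{k+1}\}$. *)

(* Defs.v *)
From HB Require Import structures.
From mathcomp Require Import all_boot all_order all_algebra.
From mathcomp Require Import all_classical all_reals all_analysis.

Set Implicit Arguments.
Unset Strict Implicit.
Unset Printing Implicit Defensive.

Import Order.TTheory GRing.Theory Num.Theory.
Import numFieldNormedType.Exports.

Local Open Scope classical_set_scope.
Local Open Scope ring_scope.

Section Euclidean.
Variables (R : realType) (m : nat).
Implicit Types (x y v : 'rV[R]_m) (S : set 'rV[R]_m) (A : 'M[R]_m).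

Definition dot x y : R := \sum_(i < m) x ord0 i * y ord0 i.

(* The library norm on ['rV[R]_m] is the sup norm: it gives the right topology
   and bounded sets, but not the Euclidean constants. *)
Definition enorm x : R := Num.sqrt (dot x x).

Definition edist_set x S : R := inf [set enorm (x - y) | y in S].

(* Operator norm induced by the Euclidean norm, [A] acting on row vectors. *)
Definition opnorm A : R := sup [set enorm (v *m A) | v in [set v | enorm v <= 1]].

Definition psd A := forall v, 0 <= dot (v *m A) v.

End Euclidean.

Section Calculus.
Variables (R : realType) (m : nat).
Implicit Types (f : 'rV[R]_m -> R) (x : 'rV[R]_m).

Definition grad f x : 'rV[R]_m := \row_i 'd f x (delta_mx ord0 i).

(* [v *m hess f x] is the derivative of [grad f] at [x] in the direction [v]. *)
Definition hess f x : 'M[R]_m := 'J (grad f) x.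

Definition C2 f :=
  [/\ forall x, differentiable f x,
      forall x, differentiable (grad f) x &
      continuous (hess f)].

Definition second_order_stationary f : set 'rV[R]_m :=
  [set x | grad f x = 0 /\ psd (hess f x)].

End Calculus.

Section Optimization.
Variables (R : realType) (m : nat).
Implicit Types (f : 'rV[R]_m -> R) (x y : 'rV[R]_m) (F : set 'rV[R]_m).

Definition sublevel f (a : R) : set 'rV[R]_m := [set y | f y <= a].

Definition argmin f (D : set 'rV[R]_m) : set 'rV[R]_m :=
  [set x | D x /\ forall y, D y -> f x <= f y].

Record assumptionA f F x0 (q L1 L2 : R) : Prop := AssumptionA {
  f_C2 : C2 f ;
  f_bounded_below : has_lbound (range f) ;
  F_closed : closed F ;
  F_convex : convex_set F ;
  F_interior_nonempty : interior F !=set0 ;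
  sublevel_sub_F : sublevel f (f x0) `<=` interior F ;
  x0_in_F : interior F x0 ;
  q_gt0 : 0 < q ;
  q_le1 : q <= 1 ;
  L1_gt0 : 0 < L1 ;
  L2_gt0 : 0 < L2 ;
  grad_lipschitz : forall x y, F x -> F y ->
    enorm (grad f x - grad f y) <= L1 * enorm (x - y) ;
  hess_holder : forall x y, F x -> F y ->
    opnorm (hess f x - hess f y) <= L2 * enorm (x - y) `^ q }.

Definition model f (q sigma : R) x y : R :=
  f x + dot (grad f x) (y - x) + 2^-1 * dot ((y - x) *m hess f x) (y - x)
  + sigma / ((q + 1) * (q + 2)) * enorm (y - x) `^ (q + 2).

Record algorithm1_run f (q L2 sbar zeta : R) x0
    (sigma : nat -> R) (xhat xtil x : nat -> 'rV[R]_m) : Prop := Algorithm1Run {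
  run_x0 : x 0%N = x0 ;
  run_xhat0 : xhat 0%N = x0 ;
  run_sigma : forall k, sbar <= sigma k <= 2 * L2 ;
  run_xhat : forall k, argmin (model f q (sigma k) (x k)) setT (xhat k.+1) ;
  run_xtil : forall k,
    let beta := Num.min zeta
      (Num.min (enorm (grad f (xhat k.+1))) (enorm (xhat k.+1 - x k))) in
    xtil k.+1 = xhat k.+1 + beta *: (xhat k.+1 - xhat k) ;
  run_x : forall k, argmin f [set xhat k.+1; xtil k.+1] (x k.+1) }.

Definition generated_by_algorithm1 f (q L2 sbar zeta : R) x0
    (x : nat -> 'rV[R]_m) : Prop :=
  [/\ 2 * L2 / (q + 2) < sbar <= L2, 0 <= zeta < 1 &
      exists sigma xhat xtil,
        algorithm1_run f q L2 sbar zeta x0 sigma xhat xtil x].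

End Optimization.

Section Admissible.
Variable R : realType.
Implicit Types psi : R -> R.

(* A function on [0, oo) is represented by a function on R whose values at
   negative arguments are irrelevant. *)
Definition admissible psi :=
  [/\ forall t, 0 <= t -> 0 <= psi t,
      psi 0 = 0 &
      forall t : nat -> R, (forall n, 0 <= t n) ->
        (psi (t n) @[n --> \oo] --> (0 : R)) -> t n @[n --> \oo] --> (0 : R)].

Definition increasing_nneg psi :=
  forall s t, 0 <= s -> s < t -> psi s < psi t.

(* The inverse of an increasing function on [0, oo). By [inv_nnegK] it is the
   inverse function on the range of [psi]; the supremum only extends it across
   the jumps of [psi], so that [psi] need not be onto [0, oo). *)
Definition inv_nneg psi (s : R) : R := sup [set t | 0 <= t /\ psi t <= s].

Lemma inv_nnegK psi t : increasing_nneg psi -> 0 <= t -> inv_nneg psi (psi t) = t.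
Proof.
move=> psi_inc t0.
have ubt : ubound [set u | 0 <= u /\ psi u <= psi t] t.
  move=> u [u0 ut]; rewrite leNgt; apply/negP => /(psi_inc _ _ t0).
  by rewrite ltNge ut.
apply/le_anti/andP; split; first by apply: ge_sup => //; exists t.
by apply: ub_le_sup; [exists t | split].
Qed.

End Admissible.

Section Rate.
Variable R : realType.

Definition gamma (q L2 sbar zeta gap : R) : R :=
  (1 - zeta)^-1 *
  (2 * (q + 1) * (q + 2) / ((q + 2) * sbar - 2 * L2) * gap) `^ (q + 2)^-1.

Definition ell_eq (q L2 sbar t : R) : Prop :=
  sbar * t `^ (q + 1) - 2 * sbar * t `^ q - L2 * (q + 1) * t - L2 = 0.

Definition tau (psi : R -> R) (q L1 L2 gam ell t : R) : R :=
  inv_nneg psi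
    (3 * (1 + gam * L1) * L2 * ell `^ (q + 1) / (q + 1) * t `^ (q + 1)).

End Rate.

(* Main.v *)
Require Import Defs.
From HB Require Import structures.
From mathcomp Require Import all_boot all_order all_algebra.
From mathcomp Require Import ring lra.
From mathcomp Require Import all_classical all_reals all_analysis.

Import Order.TTheory GRing.Theory Num.Theory.
Import numFieldNormedType.Exports.

Local Open Scope classical_set_scope.
Local Open Scope ring_scope.

(** Write [g], [H] for the gradient and Hessian of [f] at the iterate [x k], and
    [s = xhat k.+1 - x k], [r = |s|], [rho k] for the distance from [x k] to the
    set Theta of second-order stationary points.

    A minimizer of the regularized quadratic model satisfies
    [g + s H + sigma/(q+1) r^q s = 0] ([step_stationary]; this uses the symmetry
    of the Hessian, [hess_sym]) and [g . s <= 0].  Combined with the Taylor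
    bounds [fun_taylor] and [grad_taylor] this gives three estimates of one
    step: [f] decreases by a multiple of [r^(q+2)] ([step_descent]), the new
    gradient is at most [3 L2/(q+1) r^(q+1)] ([step_grad]), and [r] is at most
    [ell] times the distance to any point of Theta in [F] ([step_le_dist]; this
    is where the equation of [ell] comes from).  The momentum correction is at
    most [gamma] times the gradient and at most [gamma r], so it only costs the
    factors [1 + gamma L1] for the gradient ([run_grad_le]) and [1 + gamma] for
    the length of the step ([run_step_le]).

    Since [f] is bounded below, [r] tends to 0.  Hence the gradients tend to 0,
    and comparing the model at an arbitrary displacement with its minimum shows
    that an accumulation point [xbar] has a positive semidefinite Hessian
    ([cluster_stationary]).

    Near [xbar] the error bound turns the gradient estimate into
    [psi (rho k.+1) <= c (rho k)^(q+1)], that is, [rho k.+1 <= tau (rho k)],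
    which is at most [kappa rho k] for some [kappa < 1].  As the steps are at
    most [C rho k], the quantity [|x k - xbar| + C/(1 - kappa) rho k] does not
    increase once it is small, and it becomes arbitrarily small because [xbar]
    is an accumulation point.  This gives convergence ([trapped_cvg]), and
    summing the remaining steps gives [|x k - xbar| <= C/(1 - kappa) rho k]
    ([trapped_rate]).  The rate follows:
    [|x k.+1 - xbar| <= C/(1 - kappa) rho k.+1 <= C/(1 - kappa) tau (rho k)],
    and [tau] is monotone near 0 with [rho k <= |x k - xbar|]. *)

(** * Euclidean geometry on row vectors *)

Section EuclideanSpace.
Context {R : realType} {m : nat}.
Implicit Types (x y z v w : 'rV[R]_m) (A : 'M[R]_m) (a b : R).

Lemma dotC x y : dot x y = dot y x.
Proof. by apply: eq_bigr => i _; rewrite mulrC. Qed.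

Lemma dotDl x y z : dot (x + y) z = dot x z + dot y z.
Proof. by rewrite -big_split; apply: eq_bigr => i _; rewrite mxE mulrDl. Qed.

Lemma dotZl a x y : dot (a *: x) y = a * dot x y.
Proof. by rewrite mulr_sumr; apply: eq_bigr => i _; rewrite mxE mulrA. Qed.

Lemma dotNl x y : dot (- x) y = - dot x y.
Proof. by rewrite -scaleN1r dotZl mulN1r. Qed.

Lemma dotBl x y z : dot (x - y) z = dot x z - dot y z.
Proof. by rewrite dotDl dotNl. Qed.

Lemma dot0l x : dot 0 x = 0.
Proof. by rewrite -(scale0r 0) dotZl mul0r. Qed.

Lemma dotDr x y z : dot z (x + y) = dot z x + dot z y.
Proof. by rewrite dotC dotDl !(dotC z). Qed.

Lemma dotZr a x y : dot x (a *: y) = a * dot x y.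
Proof. by rewrite dotC dotZl dotC. Qed.

Lemma dotNr x y : dot x (- y) = - dot x y.
Proof. by rewrite dotC dotNl dotC. Qed.

Lemma dotBr x y z : dot z (x - y) = dot z x - dot z y.
Proof. by rewrite dotDr dotNr. Qed.

Lemma dot0r x : dot x 0 = 0.
Proof. by rewrite dotC dot0l. Qed.

Lemma dot_ge0 x : 0 <= dot x x.
Proof. by apply: sumr_ge0 => i _; rewrite -expr2 sqr_ge0. Qed.

Lemma dot_eq0 x : dot x x = 0 -> x = 0.
Proof.
move=> /eqP; rewrite psumr_eq0; last by move=> i _; rewrite -expr2 sqr_ge0.
move=> /allP h; apply/rowP => i; rewrite mxE; apply/eqP.
by have := h i (mem_index_enum _); rewrite -expr2 sqrf_eq0.
Qed.

Lemma enorm_ge0 x : 0 <= enorm x. Proof. exact: sqrtr_ge0. Qed.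

Lemma enorm_sqr x : enorm x ^+ 2 = dot x x.
Proof. by rewrite sqr_sqrtr ?dot_ge0. Qed.

Lemma enorm0 : enorm (0 : 'rV[R]_m) = 0.
Proof. by rewrite /enorm dot0l sqrtr0. Qed.

Lemma enorm0_eq0 x : enorm x = 0 -> x = 0.
Proof. by move=> h; apply: dot_eq0; rewrite -enorm_sqr h expr0n. Qed.

Lemma enormZ a x : enorm (a *: x) = `|a| * enorm x.
Proof. by rewrite /enorm dotZl dotZr mulrA -expr2 sqrtrM ?sqr_ge0 // sqrtr_sqr. Qed.

Lemma enormN x : enorm (- x) = enorm x.
Proof. by rewrite /enorm dotNl dotNr opprK. Qed.

Lemma enormC x y : enorm (x - y) = enorm (y - x).
Proof. by rewrite -enormN opprB. Qed.

Lemma cauchy_schwarz x y : dot x y <= enorm x * enorm y.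
Proof.
have [y0|y0] := eqVneq (dot y y) 0.
  by rewrite (dot_eq0 _ y0) dot0r enorm0 mulr0.
have yy : 0 < dot y y by rewrite lt_def y0 dot_ge0.
have [xy|xy] := leP (dot x y) 0.
  by apply: le_trans xy _; rewrite mulr_ge0 ?enorm_ge0.
rewrite -(@ler_pXn2r _ 2) ?nnegrE ?mulr_ge0 ?enorm_ge0 ?(ltW xy) //.
rewrite exprMn !enorm_sqr.
have := dot_ge0 (dot y y *: x - dot x y *: y).
rewrite !(dotBl, dotBr, dotZl, dotZr) (dotC y x).
set a := dot x x; set b := dot x y; set c := dot y y => h.
have {}h : 0 <= c * (a * c - b ^+ 2) by rewrite expr2; lra.
by move: h; rewrite pmulr_rge0 // subr_ge0.
Qed.

Lemma cauchy_schwarz_norm x y : `|dot x y| <= enorm x * enorm y.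
Proof.
rewrite ler_norml cauchy_schwarz andbT lerNl -dotNl -(enormN x).
exact: cauchy_schwarz.
Qed.

Lemma enormD x y : enorm (x + y) <= enorm x + enorm y.
Proof.
rewrite -(@ler_pXn2r _ 2) ?nnegrE ?addr_ge0 ?enorm_ge0 // sqrrD !enorm_sqr.
rewrite dotDl !dotDr (dotC y x).
have := cauchy_schwarz x y; lra.
Qed.

Lemma enorm_triangle z x y : enorm (x - y) <= enorm (x - z) + enorm (z - y).
Proof. by have := enormD (x - z) (z - y); rewrite addrA subrK. Qed.

Lemma enorm_le_sub x y : enorm x <= enorm (x - y) + enorm y.
Proof. by have := enormD (x - y) y; rewrite subrK. Qed.

(** Testing a vector against itself turns scalar bounds into norm bounds. *)
Lemma enorm_le_dual x a : 0 <= a -> dot x x <= a * enorm x -> enorm x <= a.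
Proof.
move=> a0; have [->|x0] := eqVneq (enorm x) 0; first by [].
have xp : 0 < enorm x by rewrite lt_def x0 enorm_ge0.
by rewrite -enorm_sqr expr2 ler_pM2r.
Qed.

Lemma coord_le_enorm x i : `|x ord0 i| <= enorm x.
Proof.
rewrite -(@ler_pXn2r _ 2) ?nnegrE ?enorm_ge0 ?normr_ge0 // enorm_sqr.
rewrite real_normK ?num_real // /dot (bigD1 i) //= -expr2 lerDl.
by apply: sumr_ge0 => j _; rewrite -expr2 sqr_ge0.
Qed.

Lemma mxnorm_le_enorm x : `|x| <= enorm x.
Proof.
rewrite [leLHS]mx_normrE; apply: bigmax_le; first exact: enorm_ge0.
by move=> [i j] _ /=; rewrite ord1 coord_le_enorm.
Qed.

(** A crude Frobenius bound; it only serves to make [opnorm] a genuine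
    supremum. *)
Lemma mulmx_enorm_bounded A :
  exists2 C, 0 <= C & forall v, enorm (v *m A) <= C * enorm v.
Proof.
pose c j := enorm (\row_i A i j).
have c0 : 0 <= \sum_j c j ^+ 2 by apply: sumr_ge0 => j _; exact: sqr_ge0.
exists (Num.sqrt (\sum_j c j ^+ 2)); first exact: sqrtr_ge0.
move=> v; rewrite -(@ler_pXn2r _ 2) ?nnegrE ?mulr_ge0 ?enorm_ge0 ?sqrtr_ge0 //.
rewrite exprMn enorm_sqr sqr_sqrtr // mulr_suml; apply: ler_sum => j _.
have -> : (v *m A) ord0 j = dot v (\row_i A i j).
  by rewrite mxE; apply: eq_bigr => i _; rewrite mxE.
rewrite -expr2 -exprMn mulrC -real_normK ?num_real //.
by rewrite ler_pXn2r ?nnegrE ?mulr_ge0 ?enorm_ge0 // cauchy_schwarz_norm.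
Qed.

Lemma enorm_mulmx A v : enorm (v *m A) <= opnorm A * enorm v.
Proof.
have [->|v0] := eqVneq v 0; first by rewrite mul0mx enorm0 mulr0.
have vp : 0 < enorm v.
  by rewrite lt_def enorm_ge0 andbT; apply: contraNneq v0 => /enorm0_eq0 ->.
rewrite -ler_pdivrMr // mulrC -[X in X * _]ger0_norm ?invr_ge0 ?enorm_ge0 //.
rewrite -enormZ scalemxAl; apply: ub_le_sup.
  have [C C0 CA] := mulmx_enorm_bounded A.
  exists C => _ [u /= u1 <-]; apply: le_trans (CA u) _.
  by rewrite -[leRHS]mulr1 ler_wpM2l.
exists ((enorm v)^-1 *: v) => //=.
by rewrite enormZ ger0_norm ?invr_ge0 ?enorm_ge0 // mulVf // gt_eqF.
Qed.

Lemma continuous_sum (T : topologicalType) n (u : 'I_n -> T -> R) :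
  (forall i, continuous (u i)) -> continuous (fun t => \sum_i u i t).
Proof.
move=> cu t; elim: (index_enum _) => [|i s IH].
  have -> : (fun s => \sum_(i <- [::]) u i s) = cst 0.
    by apply/funext => s; rewrite big_nil.
  exact: cst_continuous.
have -> : (fun r => \sum_(i <- i :: s) u i r) =
    (fun r => u i r + \sum_(i <- s) u i r).
  by apply/funext => r; rewrite big_cons.
by apply: cvgD => //; exact: cu.
Qed.

Lemma continuous_dot (T : topologicalType) (u v : T -> 'rV[R]_m) :
  continuous u -> continuous v -> continuous (fun t => dot (u t) (v t)).
Proof.
move=> cu cv; apply: continuous_sum => i t.
apply: cvgM.
  exact: (continuous_comp (cu t) (@coord_continuous _ _ _ ord0 i _)).
exact: (continuous_comp (cv t) (@coord_continuous _ _ _ ord0 i _)).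
Qed.

Lemma continuous_quadratic_form (v : 'rV[R]_m) :
  continuous (fun A : 'M[R]_m => dot (v *m A) v).
Proof.
apply: continuous_sum => j A.
apply: (@continuousM R _ (fun B : 'M[R]_m => (v *m B) ord0 j)
    (fun _ : 'M[R]_m => v ord0 j)); last exact: cst_continuous.
have -> : (fun B : 'M[R]_m => (v *m B) ord0 j) =
    (fun B => \sum_i v ord0 i * B i j).
  by apply/funext => B; rewrite mxE.
apply: continuous_sum => i B.
apply: (@continuousM R _ (fun _ : 'M[R]_m => v ord0 i)
    (fun B : 'M[R]_m => B i j)); first exact: cst_continuous.
exact: coord_continuous.
Qed.

Lemma continuous_enorm : continuous (@enorm R m).
Proof.
move=> x; apply: continuous_comp; last exact: sqrt_continuous.
by apply: continuous_dot => y; exact: cvg_id.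
Qed.

End EuclideanSpace.

(** * Mean value inequalities against powers *)

Section PowerIncrement.
Context {R : realType}.
Implicit Types (p c t : R).

Lemma le_of_eq (a b : R) : a = b -> a <= b.
Proof. by move->. Qed.

Lemma powR_addr1 a p : 0 <= a -> 0 <= p -> a `^ (p + 1) = a `^ p * a.
Proof.
by move=> a0 p0; rewrite mulrC -(@mulr_powRB1 _ a (p + 1)) ?addrK // ltr_wpDl.
Qed.

(** Continuity holds only from the right at 0, because [powR] takes the value 1
    at negative arguments. *)
Lemma powR_continuous_itv01 p : 0 < p ->
  {within `[0, 1], continuous (fun t : R => t `^ p)}.
Proof.
move=> p0; apply/continuous_within_itvP; first exact: ltr01.
have cont t : 0 < t -> {for t, continuous (fun t : R => t `^ p)}.
  move=> t0; apply/differentiable_continuous/derivable1_diffP.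
  have d := is_derive1_powR p t0; exact: ex_derive.
split.
- by move=> t; rewrite in_itv /= => /andP[t0 _]; exact: cont.
- by rewrite powR0 ?gt_eqF //; exact: powR_cvg0.
- by apply: cvg_at_left_filter; apply: cont.
Qed.

(** The mean value inequality against a multiple of [t `^ (p + 1)]: it plays
    the part of integrating the bound on the derivative. *)
Lemma increment_le_powR (phi dphi : R -> R) p c : 0 <= p ->
  (forall t, is_derive t 1 phi (dphi t)) ->
  (forall t, 0 < t < 1 -> dphi t <= c * t `^ p) ->
  phi 1 - phi 0 <= c / (p + 1).
Proof.
move=> p0 dphiP phile.
have p1 : 0 < p + 1 by lra.
pose chi : R -> R := phi - (fun t : R => c / (p + 1) *: t `^ (p + 1)).
have chi_derive t : t \in `]0, 1[%R ->
    is_derive t 1 chi (dphi t - c / (p + 1) *: ((p + 1) * t `^ (p + 1 - 1))).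
  rewrite in_itv /= => /andP[t0 _].
  have ? := dphiP t; have ? := is_derive1_powR (p + 1) t0.
  exact: is_deriveB.
have /(_ 0 1) : forall x y, 0 <= x -> x <= y -> y <= 1 -> chi y <= chi x.
  apply: ler0_derive1_nincr.
  - by move=> t /chi_derive d; exact: ex_derive.
  - move=> t t01; have d := chi_derive t t01; rewrite derive1E derive_val.
    move: t01; rewrite in_itv /= => /phile.
    rewrite addrK [_ *: _]mulrA divfK ?gt_eqF //.
    by rewrite subr_le0.
  - have cphi : {within `[0, 1], continuous phi}.
      apply: continuous_subspaceT => s.
      by apply/differentiable_continuous/derivable1_diffP; exact: ex_derive.
    have cpow := powR_continuous_itv01 _ p1.
    move=> t; have := cvgB (cphi t) (cvgZl_tmp (k := c / (p + 1)) (cpow t)).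
    exact.
have chiE t : chi t = phi t - c / (p + 1) * t `^ (p + 1) by [].
move=> /(_ (lexx _) ler01 (lexx _)).
by rewrite !chiE powR0 ?gt_eqF // powR1; lra.
Qed.

Lemma increment_norm_le_powR (phi dphi : R -> R) p c : 0 <= p ->
  (forall t, is_derive t 1 phi (dphi t)) ->
  (forall t, 0 < t < 1 -> `|dphi t| <= c * t `^ p) ->
  `|phi 1 - phi 0| <= c / (p + 1).
Proof.
move=> p0 dphiP phile; rewrite ler_norml; apply/andP; split.
  rewrite lerNl opprB.
  have := @increment_le_powR (- phi) (fun t => - dphi t) p c p0.
  have -> : (- phi) 1 - (- phi) 0 = phi 0 - phi 1.
    by rewrite ![(- phi) _]/(- _) opprK addrC.
  apply.
  by move=> t /phile; rewrite ler_norml lerNl => /andP[].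
apply: increment_le_powR p0 dphiP _.
by move=> t /phile; rewrite ler_norml => /andP[].
Qed.

End PowerIncrement.

Section Lines.
Context {R : realType} {m : nat}.
Implicit Types (f : 'rV[R]_m -> R) (x y h e : 'rV[R]_m) (t : R).

Lemma is_derive_line (V : normedModType R) (G : 'rV[R]_m -> V) x h t :
  differentiable G (x + t *: h) ->
  is_derive t 1 (fun s : R => G (x + s *: h)) ('d G (x + t *: h) h).
Proof.
move=> dG; have dv := @diff_derivable _ _ _ _ _ h dG; have e := deriveE h dG.
have E : (fun k : R => k^-1 *: (((fun s : R => G (x + s *: h)) \o shift t) (k *: 1)
      - G (x + t *: h))) =
    (fun k : R => k^-1 *: ((G \o shift (x + t *: h)) (k *: h) - G (x + t *: h))).
  apply/funext => k /=; congr (_ *: (G _ - _)).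
  by rewrite [k *: 1]mulr1 scalerDl addrCA.
split; first by rewrite /derivable E.
by rewrite -e /derive E.
Qed.

Lemma is_derive_dot e (G : R -> 'rV[R]_m) t dG : is_derive t 1 G dG ->
  is_derive t 1 (fun s => dot e (G s)) (dot e dG).
Proof.
move=> [cG <-].
have dotc : continuous (dot e).
  apply: continuous_dot; first exact: cst_continuous.
  by move=> ?; exact: cvg_id.
have E : (fun k : R => k^-1 *: (((fun s => dot e (G s)) \o shift t) (k *: 1)
      - dot e (G t))) =
    dot e \o (fun k : R => k^-1 *: ((G \o shift t) (k *: 1) - G t)).
  by apply/funext => k /=; rewrite dotZr dotBr.
have cv : dot e \o (fun k : R => k^-1 *: ((G \o shift t) (k *: 1) - G t)) @ 0^' -->
    dot e ('D_1 G t) by apply: continuous_cvg cG; exact: dotc.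
by split; rewrite /derivable /derive E; [apply/cvg_ex; eexists; exact: cv|exact: cvg_lim].
Qed.

Lemma dot_grad f x h : differentiable f x -> dot (grad f x) h = 'd f x h.
Proof.
move=> df; rewrite {2}(row_sum_delta h) linear_sum; apply: eq_bigr => i _.
by rewrite linearZ mxE mulrC.
Qed.

Lemma mulmx_hess f x h : h *m hess f x = 'd (grad f) x h.
Proof. by rewrite /hess /jacobian mul_rV_lin1. Qed.

End Lines.

(** * Taylor bounds under a Hoelder Hessian *)

(** The shape of a function restricted to a segment minus its Taylor
    polynomial. *)
Lemma is_derive_sub_quadratic {R : realType} (u : R -> R) (du a b t : R) :
  is_derive t 1 u du ->
  is_derive t 1 (fun s => u s - (a * s + b * s ^+ 2)) (du - (a + 2 * b * t)).
Proof.
move=> du_t.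
have E : (fun s => u s - (a * s + b * s ^+ 2)) =
    u - (a *: id + b *: (id ^+ 2)) by apply/funext => s; rewrite !fctE.
have dq : is_derive t 1 (a *: id + b *: (id ^+ 2) : R -> R) (a + 2 * b * t).
  have did := is_derive_id t (1 : R).
  have dX := @is_deriveX _ _ id 2 t 1 1 did.
  have := is_deriveD (is_deriveZ a did) (is_deriveZ b dX).
  congr is_derive; rewrite /GRing.scale /= expr1; ring.
by rewrite E; exact: is_deriveB.
Qed.

#[local] Opaque hess grad.

Section Taylor.
Context {R : realType} {m : nat}.
Context {f : 'rV[R]_m -> R} {F : set 'rV[R]_m} {q L : R}.
Hypothesis fC2 : C2 f.
Hypothesis Fconvex : convex_set F.
Hypothesis q_ge0 : 0 <= q.
Hypothesis L_ge0 : 0 <= L.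
Hypothesis holder : forall x y, F x -> F y ->
  opnorm (hess f x - hess f y) <= L * enorm (x - y) `^ q.
Implicit Types (x y h v : 'rV[R]_m) (t : R).

Let q1_gt0 : 0 < q + 1. Proof. by rewrite ltr_wpDl. Qed.
Let q2_gt0 : 0 < q + 2. Proof. by rewrite ltr_wpDl. Qed.

Lemma convex_segment x y t : F x -> F y -> 0 <= t <= 1 -> F (x + t *: (y - x)).
Proof.
move=> Fx Fy /andP[t0 t1].
have i01 : Itv.spec (@Itv.num_sem R) (Itv.Real `[0, 1]%Z) t.
  by rewrite /= /Itv.num_sem ger0_real //= in_itv /= t0 t1.
have := @Fconvex y x (Itv.mk i01).
rewrite !inE => /(_ Fy Fx); congr (F _).
rewrite /conv /= /unstable.onem scalerBl scale1r scalerBr.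
by rewrite addrCA.
Qed.

Lemma enorm_hess_diff x y v : F x -> F y ->
  enorm (v *m (hess f x - hess f y)) <= L * enorm (x - y) `^ q * enorm v.
Proof.
move=> Fx Fy; apply: le_trans (enorm_mulmx _ _) _.
by apply: ler_wpM2r; [exact: enorm_ge0 | exact: holder].
Qed.

Lemma segment_powR x h t p : 0 <= t ->
  enorm (x + t *: h - x) `^ p = enorm h `^ p * t `^ p.
Proof.
by move=> t0; rewrite addrC addKr enormZ ger0_norm // powRM ?enorm_ge0 // mulrC.
Qed.

(** The error vector, paired with itself, is the increment along the segment of
    a scalar function whose derivative is a Hessian difference, hence at most a
    multiple of [t ^ q]. *)
Lemma grad_taylor x y : F x -> F y ->
  enorm (grad f y - grad f x - (y - x) *m hess f x) <=
    L / (q + 1) * enorm (y - x) `^ (q + 1).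
Proof.
have [df dg _] := fC2 => Fx Fy; set h := y - x; set e := _ - _ - _.
apply: enorm_le_dual.
  by rewrite !mulr_ge0 ?powR_ge0 ?invr_ge0 ?addr_ge0.
pose c := dot e (h *m hess f x).
(* The gradient expansion has no quadratic term: the coefficient is 0. *)
pose phi t := dot e (grad f (x + t *: h)) - (c * t + 0 * t ^+ 2).
pose dphi t := dot e (h *m hess f (x + t *: h)) - (c + 2 * 0 * t).
have : phi 1 - phi 0 <= (L * enorm h `^ (q + 1) * enorm e) / (q + 1).
  apply: (@increment_le_powR _ phi dphi q) => //.
    move=> t; apply: is_derive_sub_quadratic; apply: is_derive_dot.
    by rewrite mulmx_hess; exact: is_derive_line.
  move=> t /andP[t0 t1].
  have -> : dphi t = dot e (h *m (hess f (x + t *: h) - hess f x)).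
    have drop0 (u v : R) : u - (v + 2 * 0 * t) = u - v by ring.
    by rewrite /dphi drop0 /c mulmxBr dotBr.
  apply: le_trans (cauchy_schwarz _ _) _.
  have Ft : F (x + t *: h) by apply: convex_segment => //; rewrite !ltW.
  rewrite mulrC -[leRHS]mulrA [enorm e * _]mulrC [leRHS]mulrA.
  apply: ler_wpM2r; first exact: enorm_ge0.
  apply: le_trans (enorm_hess_diff _ _ _ Ft Fx) _.
  rewrite segment_powR ?(ltW t0) // powR_addr1 ?enorm_ge0 //.
  by rewrite !mulrA (mulrAC _ (t `^ q)).
have -> : phi 1 - phi 0 = dot e e.
  have drop0 (u v w : R) :
    u - (w * 1 + 0 * 1 ^+ 2) - (v - (w * 0 + 0 * 0 ^+ 2)) = u - v - w by ring.
  have -> : phi 1 = dot e (grad f y) - (c * 1 + 0 * 1 ^+ 2).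
    by rewrite /phi scale1r subrKC.
  have -> : phi 0 = dot e (grad f x) - (c * 0 + 0 * 0 ^+ 2).
    by rewrite /phi scale0r addr0.
  by rewrite drop0 /c -!dotBr.
by rewrite mulrAC (mulrAC L).
Qed.

(** Integrating the first-order expansion of the gradient along the segment. *)
Lemma fun_taylor x y : F x -> F y ->
  `|f y - f x - dot (grad f x) (y - x)
     - 2^-1 * dot ((y - x) *m hess f x) (y - x)| <=
    L / ((q + 1) * (q + 2)) * enorm (y - x) `^ (q + 2).
Proof.
have [df dg _] := fC2 => Fx Fy; set h := y - x.
set a := dot (grad f x) h; set b := 2^-1 * _.
pose phi t := f (x + t *: h) - (a * t + b * t ^+ 2).
pose dphi t := dot (grad f (x + t *: h)) h - (a + 2 * b * t).
have : `|phi 1 - phi 0| <= (L / (q + 1) * enorm h `^ (q + 2)) / (q + 1 + 1).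
  apply: (@increment_norm_le_powR _ phi dphi (q + 1)); first exact: ltW.
    move=> t; apply: is_derive_sub_quadratic.
    by rewrite dot_grad //; exact: is_derive_line.
  move=> t /andP[t0 t1].
  have Ft : F (x + t *: h) by apply: convex_segment => //; rewrite !ltW.
  have -> : dphi t =
      dot (grad f (x + t *: h) - grad f x - (x + t *: h - x) *m hess f x) h.
    have alg (u v w : R) : u - (v + 2 * (2^-1 * w) * t) = u - v - t * w by field.
    have -> : x + t *: h - x = t *: h by rewrite addrC addKr.
    by rewrite -scalemxAl !dotBl dotZl -alg.
  apply: le_trans (cauchy_schwarz_norm _ _) _.
  apply: (@le_trans _ _ (L / (q + 1) * enorm (x + t *: h - x) `^ (q + 1) * enorm h)).
    by apply: ler_wpM2r; [exact: enorm_ge0|exact: grad_taylor].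
  rewrite segment_powR ?(ltW t0) //.
  have -> : enorm h `^ (q + 2) = enorm h `^ (q + 1) * enorm h.
    have -> : q + 2 = q + 1 + 1 by ring.
    by rewrite powR_addr1 ?enorm_ge0 // ltW.
  by apply: le_of_eq; ring.
have -> : phi 1 - phi 0 = f y - f x - a - b.
  have alg (u v : R) :
    u - (a * 1 + b * 1 ^+ 2) - (v - (a * 0 + b * 0 ^+ 2)) = u - v - a - b by ring.
  have -> : phi 1 = f y - (a * 1 + b * 1 ^+ 2).
    by rewrite /phi scale1r subrKC.
  have -> : phi 0 = f x - (a * 0 + b * 0 ^+ 2).
    by rewrite /phi scale0r addr0.
  exact: alg.
move/le_trans; apply; apply: le_of_eq; field.
by rewrite !gt_eqF.
Qed.

End Taylor.

(** * Symmetry of the Hessian *)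

Section VanishingPowers.
Context {R : realType}.

Lemma le0_of_le_powR (a K q : R) : 0 < q ->
  (\forall t \near (0 : R)^'+, a <= K * t `^ q) -> a <= 0.
Proof.
move=> q0 aK.
have lim0 : K * t `^ q @[t --> (0 : R)^'+] --> (K * 0).
  by apply: cvgM; [exact: cvg_cst|exact: powR_cvg0].
by rewrite mulr0 in lim0; exact: (cvgr_to_ge lim0).
Qed.

End VanishingPowers.

Section HessianSymmetry.
Context {R : realType} {m : nat}.
Context {f : 'rV[R]_m -> R} {F : set 'rV[R]_m} {q L : R}.
Hypothesis fC2 : C2 f.
Hypothesis Fconvex : convex_set F.
Hypothesis q_gt0 : 0 < q.
Hypothesis L_ge0 : 0 <= L.
Hypothesis holder : forall x y, F x -> F y ->
  opnorm (hess f x - hess f y) <= L * enorm (x - y) `^ q.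
Implicit Types (x h k : 'rV[R]_m).

Lemma near_interior_line x h : interior F x ->
  \forall t \near (0 : R)^'+, F (x + t *: h).
Proof.
move=> Fx.
have line_cvg : x + t *: h @[t --> (0 : R)^'+] --> x + 0 *: h.
  by apply: cvg_at_right_filter; apply: cvgD;
    [exact: cvg_cst|exact: scalel_continuous].
by rewrite scale0r addr0 in line_cvg; exact: line_cvg.
Qed.

(** The scalar core of [hess_sym], with [P = t ^ q]: in a suitable combination
    of five expansion errors of order [t ^ 2 * P], everything cancels except
    [t ^ 2 * (hk - kh)]. *)
Fact symmetry_alg (F2 F1 f0 gh gk Gk hh hk kh kk KK t P A1 A2 A3 c1 A4 nk A5 c2 L' : R) :
  0 < t ->
  `|F2 - f0 - (t * gh + t * gk) - 2^-1 * (t * (t * hh) + t * (t * kh) +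
     (t * (t * hk) + t * (t * kk)))| <= c2 * (A1 * (P * t ^+ 2)) ->
  `|F1 - f0 - t * gh - 2^-1 * (t * (t * hh))| <= c2 * (A2 * (P * t ^+ 2)) ->
  `|F2 - F1 - t * Gk - 2^-1 * (t * (t * KK))| <= c2 * (A3 * (P * t ^+ 2)) ->
  `|t * Gk - t * gk - t * (t * hk)| <= c1 * (A4 * (P * t)) * (t * nk) ->
  `|KK - kk| <= L' * (A5 * P) * nk * nk ->
  hk - kh <= 2 * (c2 * A1 + c2 * A2 + c2 * A3 + c1 * A4 * nk +
    2^-1 * (L' * A5 * nk * nk)) * P.
Proof.
move=> t0; rewrite !ler_norml => /andP[_ h1] /andP[h2 _] /andP[h3 _] /andP[h4 _] /andP[h5 _].
rewrite -(@ler_pM2r _ (t ^+ 2)) ?exprn_gt0 //.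
have {}h5 : t ^+ 2 * - (L' * (A5 * P) * nk * nk) <= t ^+ 2 * (KK - kk).
  by rewrite ler_pM2l ?exprn_gt0.
nra.
Qed.

(** Expanding [f (x + t (h + k))] at [x] and, in two steps, through [x + t h],
    gives the same value up to [O(t ^ (q + 2))]; comparing the [t ^ 2] terms
    yields the symmetry. *)
Lemma hess_sym x h k : interior F x ->
  dot (h *m hess f x) k = dot (k *m hess f x) h.
Proof.
move=> iFx; have Fx : F x := interior_subset iFx.
have q_ge0 := ltW q_gt0.
pose a h k := dot (h *m hess f x) k - dot (k *m hess f x) h.
suff a_le0 h' k' : a h' k' <= 0.
  apply/eqP; rewrite -subr_eq0 eq_le; apply/andP; split; first exact: a_le0.
  by rewrite -oppr_le0 opprB; exact: a_le0.
pose c1 := L / (q + 1); pose c2 := L / ((q + 1) * (q + 2)).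
pose K := 2 * (c2 * enorm (h' + k') `^ (q + 2) + c2 * enorm h' `^ (q + 2) +
  c2 * enorm k' `^ (q + 2) + c1 * enorm h' `^ (q + 1) * enorm k' +
  2^-1 * (L * enorm h' `^ q * enorm k' * enorm k')).
(* [K] collects the constants of the five error terms [T1] to [T5]. *)
apply: (@le0_of_le_powR _ _ K q) => //.
near=> t.
have t0 : 0 < t by near: t; exact: nbhs_right_gt.
have Fh : F (x + t *: h') by near: t; exact: near_interior_line.
have Fhk : F (x + t *: (h' + k')) by near: t; exact: near_interior_line.
have stepE (u : 'rV[R]_m) : x + t *: u - x = t *: u by rewrite addrC addKr.
have step2E : x + t *: (h' + k') - (x + t *: h') = t *: k'.
  by rewrite opprD addrACA subrr add0r scalerDr addrC addKr.
have normE (u : 'rV[R]_m) p : enorm (t *: u) `^ p = enorm u `^ p * t `^ p.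
  by rewrite enormZ gtr0_norm // powRM ?enorm_ge0 ?(ltW t0) // mulrC.
have T1 := fun_taylor fC2 Fconvex q_ge0 L_ge0 holder _ _ Fx Fhk.
have T2 := fun_taylor fC2 Fconvex q_ge0 L_ge0 holder _ _ Fx Fh.
have T3 := fun_taylor fC2 Fconvex q_ge0 L_ge0 holder _ _ Fh Fhk.
have T4 := grad_taylor fC2 Fconvex q_ge0 L_ge0 holder _ _ Fx Fh.
have T5 := enorm_hess_diff holder _ _ k' Fh Fx.
rewrite step2E in T3; rewrite !stepE in T1 T2 T4 T5; rewrite !normE in T1 T2 T3 T4 T5.
have {}T4 := le_trans (cauchy_schwarz_norm _ (t *: k')) (ler_wpM2r (enorm_ge0 _) T4).
have {}T5 := le_trans (cauchy_schwarz_norm _ k') (ler_wpM2r (enorm_ge0 _) T5).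
have tq2 : t `^ (q + 2) = t `^ q * t ^+ 2.
  have -> : q + 2 = q + 1 + 1 by ring.
  by rewrite !powR_addr1 ?expr2 ?mulrA ?addr_ge0 // ltW.
have tq1 : t `^ (q + 1) = t `^ q * t by rewrite powR_addr1 // ltW.
have quadE (H : 'M[R]_m) u v :
    dot (t *: u *m H) (t *: v) = t * (t * dot (u *m H) v).
  by rewrite -scalemxAl dotZl dotZr.
have quadDE (H : 'M[R]_m) u v : dot (t *: (u + v) *m H) (t *: (u + v)) =
    t * (t * dot (u *m H) u) + t * (t * dot (v *m H) u) +
    (t * (t * dot (u *m H) v) + t * (t * dot (v *m H) v)).
  by rewrite quadE mulmxDl dotDr !dotDl; ring.
have linDE (g u v : 'rV[R]_m) :
    dot g (t *: (u + v)) = t * dot g u + t * dot g v.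
  by rewrite dotZr dotDr mulrDr.
have gradE (g1 g0 u v : 'rV[R]_m) (H : 'M[R]_m) :
    dot (g1 - g0 - t *: u *m H) (t *: v) =
    t * dot g1 v - t * dot g0 v - t * (t * dot (u *m H) v).
  by rewrite dotBl quadE dotBl !dotZr.
have hessE (H1 H0 : 'M[R]_m) u :
    dot (u *m (H1 - H0)) u = dot (u *m H1) u - dot (u *m H0) u.
  by rewrite mulmxBr dotBl.
rewrite linDE quadDE tq2 in T1; rewrite dotZr quadE tq2 in T2.
rewrite dotZr quadE tq2 in T3; rewrite gradE enormZ (gtr0_norm t0) tq1 in T4.
rewrite hessE in T5.
exact: symmetry_alg t0 T1 T2 T3 T4 T5.
Unshelve. all: by end_near. Qed.
End HessianSymmetry.

(** * Stationarity of the regularized quadratic model *)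

Section ModelMinimizer.
Context {R : realType} {m : nat}.
Implicit Types (g s v : 'rV[R]_m) (H : 'M[R]_m).

Lemma derive_ge0_at_right_min (phi : R -> R) (d : R) :
  is_derive (0 : R) 1 phi d -> (forall t, 0 < t -> phi 0 <= phi t) -> 0 <= d.
Proof.
move=> [dphi <-] phi_min; have /cvg_dnbhs_at_right qlim := dphi.
apply: (cvgr_to_ge qlim); near=> t.
have t0 : 0 < t by near: t; exact: nbhs_right_gt.
rewrite /= addr0 [t *: 1]mulr1 mulr_ge0 ?invr_ge0 ?(ltW t0) //.
by rewrite subr_ge0 phi_min.
Unshelve. all: by end_near. Qed.

Lemma enorm_powR_dot s (p : R) : enorm s `^ p = dot s s `^ (p / 2).
Proof. by rewrite /enorm -powR12_sqrt ?dot_ge0 // -powRrM mulrC. Qed.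

(** The norm is differentiated through its square, a polynomial in [t] that is
    positive at [t = 0]. *)
Lemma is_derive_enorm_powR s v (q : R) : s != 0 ->
  is_derive (0 : R) 1 (fun t => enorm (s + t *: v) `^ (q + 2))
    ((q + 2) * enorm s `^ q * dot s v).
Proof.
move=> s0.
have A0 : 0 < dot s s.
  by rewrite lt_def dot_ge0 andbT; apply: contraNneq s0 => /dot_eq0 ->.
pose N t := dot s s - (- 2 * dot s v * t + - dot v v * t ^+ 2).
have NE t : dot (s + t *: v) (s + t *: v) = N t.
  by rewrite /N dotDl !dotDr !dotZl !dotZr (dotC v s); ring.
have N0 : N 0 = dot s s by rewrite -NE scale0r addr0.
have dN : is_derive (0 : R) 1 N (2 * dot s v).
  have := @is_derive_sub_quadratic R (cst (dot s s)) 0 (- 2 * dot s v)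
    (- dot v v) 0 (is_derive_cst _ _ _).
  by congr is_derive; ring.
pose P := (fun a : R => a `^ ((q + 2) / 2)).
have dP : is_derive (N 0) 1 P ((q + 2) / 2 * N 0 `^ ((q + 2) / 2 - 1)).
  by apply: is_derive1_powR; rewrite N0.
have -> : (fun t => enorm (s + t *: v) `^ (q + 2)) = P \o N.
  by apply/funext => t; rewrite /= /P -NE enorm_powR_dot.
split.
  apply/derivable1_diffP; apply: differentiable_comp;
    by apply/derivable1_diffP; exact: ex_derive.
rewrite -derive1E derive1_comp; try exact: ex_derive.
rewrite !derive1E !derive_val N0 enorm_powR_dot.
have -> : (q + 2) / 2 - 1 = q / 2 by field.
by field.
Qed.

(** The minimizer of the regularized quadratic satisfies the stationarity
    equation; at [s = 0] the regularizer is negligible against linear terms. *)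
Lemma model_min_stationary g H (c q : R) s :
  0 <= q -> 0 <= c -> (forall h k, dot (h *m H) k = dot (k *m H) h) ->
  (forall v, dot g s + 2^-1 * dot (s *m H) s + c * enorm s `^ (q + 2) <=
             dot g v + 2^-1 * dot (v *m H) v + c * enorm v `^ (q + 2)) ->
  g + s *m H + (c * (q + 2) * enorm s `^ q) *: s = 0.
Proof.
move=> q0 c0 Hsym smin; set z := _ + _ + _.
suff zv v : 0 <= dot z v.
  by apply: dot_eq0; apply: le_anti; rewrite dot_ge0 -oppr_ge0 -dotNr zv.
have quadZ (t : R) (u w : 'rV[R]_m) : dot (t *: u *m H) (t *: w) = t * (t * dot (u *m H) w).
  by rewrite -scalemxAl dotZl dotZr.
have [s_eq0|s0] := eqVneq s 0.
  have zE : dot z v = dot g v.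
    by rewrite /z s_eq0 mul0mx scaler0 !addr0.
  rewrite zE -oppr_le0.
  apply: (@le0_of_le_powR _ _ (2^-1 * `|dot (v *m H) v| + c * enorm v `^ (q + 2)) 1) => //.
  near=> t.
  have t0 : 0 < t by near: t; exact: nbhs_right_gt.
  have t1 : t <= 1 by near: t; apply: nbhs_right_le; exact: ltr01.
  have := smin (t *: v).
  rewrite s_eq0 mul0mx !dot0r mulr0 enorm0 powR0 ?mulr0 ?addr0; last first.
    by rewrite gt_eqF // ltr_wpDl.
  rewrite dotZr quadZ enormZ gtr0_norm // powRM ?enorm_ge0 ?(ltW t0) //.
  rewrite powRr1 ?(ltW t0) //.
  have -> : t `^ (q + 2) = t `^ q * t * t.
    have -> : q + 2 = q + 1 + 1 by ring.
    by rewrite !powR_addr1 ?addr_ge0 // ltW.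
  have tq : t `^ q <= 1.
    by rewrite -(powRr0 t); apply: ger_powR => //; rewrite t0.
  have cN := mulr_ge0 c0 (powR_ge0 (enorm v) (q + 2)).
  rewrite [c * (_ * _)]mulrCA.
  move: cN (ler_norm (dot (v *m H) v)) tq (powR_ge0 t q).
  set cN := c * _.
  move: (dot g v) (dot (v *m H) v) (t `^ q) => G Q T cN0 QQ T1 T0 G0.
  rewrite -(@ler_pM2r _ t) // mulNr.
  have h1 : t * (t * Q) <= t * (t * `|Q|) by rewrite !ler_pM2l.
  have h2 : T * t * t * cN <= 1 * t * t * cN.
    by rewrite ler_wpM2r // ler_wpM2r ?(ltW t0) // ler_wpM2r ?(ltW t0).
  lra.
have expand t : dot g (s + t *: v) + 2^-1 * dot ((s + t *: v) *m H) (s + t *: v) =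
    dot g s + 2^-1 * dot (s *m H) s -
    (- (dot g v + dot (s *m H) v) * t + - (2^-1 * dot (v *m H) v) * t ^+ 2).
  rewrite dotDr dotZr mulmxDl dotDl !dotDr quadZ -scalemxAl !dotZl !dotZr.
  by rewrite (Hsym v s); field.
pose phi t := c * enorm (s + t *: v) `^ (q + 2) -
  (- (dot g v + dot (s *m H) v) * t + - (2^-1 * dot (v *m H) v) * t ^+ 2).
have dphi : is_derive (0 : R) 1 phi (dot z v).
  have dpow := is_derive_enorm_powR s v q s0.
  have dcpow := is_deriveZ c dpow.
  have := is_derive_sub_quadratic _ _ (- (dot g v + dot (s *m H) v))
    (- (2^-1 * dot (v *m H) v)) 0 dcpow.
  congr is_derive; rewrite /z !dotDl dotZl /GRing.scale /=; ring.
apply: (derive_ge0_at_right_min _ _ dphi) => t t0.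
have := smin (s + t *: v); rewrite expand /phi scale0r addr0; lra.
Unshelve. all: by end_near. Qed.

(** Comparing the minimizer [s] with its reflection [- s], which differs only
    in the sign of the linear term. *)
Lemma model_min_linear_le0 g H (c p : R) s :
  (forall v, dot g s + 2^-1 * dot (s *m H) s + c * enorm s `^ p <=
             dot g v + 2^-1 * dot (v *m H) v + c * enorm v `^ p) ->
  dot g s <= 0.
Proof.
by move=> /(_ (- s)); rewrite mulNmx dotNl !dotNr enormN opprK; lra.
Qed.

End ModelMinimizer.

(** * One step of the method: descent and gradient bound *)

(** A set that is closed and meets the line in a relatively open part of the
    unit segment contains the whole segment. *)
Lemma segment_sub_closed {R : realType} {m : nat} (F : set 'rV[R]_m)
    (x s : 'rV[R]_m) :
  closed F -> F x ->
  (forall t, 0 <= t <= 1 -> F (x + t *: s) -> interior F (x + t *: s)) ->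
  forall t, 0 <= t <= 1 -> F (x + t *: s).
Proof.
move=> Fcl Fx Fint.
pose line := fun t : R => x + t *: s.
have line_cont : continuous line.
  move=> t; apply: cvgD; first exact: cvg_cst.
  exact: scalel_continuous.
pose B := `[0, 1]%classic `&` line @^-1` F.
have BE : B = `[0, 1]%classic.
  apply: (@segment_connected R 0 1).
  - by exists 0; split; rewrite /= ?in_itv /= ?lexx ?ler01 // /line scale0r addr0.
  - exists (line @^-1` interior F).
      by apply: open_comp => [? _|]; [exact: line_cont|exact: open_interior].
    rewrite eqEsubset; split => t [t01 Ft]; split => //.
      by apply: Fint => //; move: t01; rewrite /= in_itv.
    exact: interior_subset Ft.
  - exists (line @^-1` F) => //.
    by apply: closed_comp => // ? _; exact: line_cont.
move=> t t01; have : B t by rewrite BE /= in_itv.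
by case.
Qed.

(** It equals [sbar / (2 (q+1)) - L2 / ((q+1) (q+2))]: what the regularizer
    guarantees minus the Taylor error. *)
Definition decrease_constant {R : realType} (q L2 sbar : R) : R :=
  ((q + 2) * sbar - 2 * L2) / (2 * (q + 1) * (q + 2)).

Section OneStep.
Context {R : realType} {m : nat}.
Context {f : 'rV[R]_m -> R} {F : set 'rV[R]_m} {x0 : 'rV[R]_m}.
Context {q L1 L2 sbar sigma : R} {x y : 'rV[R]_m}.
Hypothesis A : assumptionA f F x0 q L1 L2.
Hypothesis sbar_gt : 2 * L2 / (q + 2) < sbar.
Hypothesis sigma_ge : sbar <= sigma.
Hypothesis x_sublevel : f x <= f x0.
Hypothesis y_argmin : argmin (model f q sigma x) setT y.

Let s := y - x.
Let r := enorm s.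

Let q_gt0 : 0 < q := q_gt0 A.
Let q_ge0 : 0 <= q. Proof. exact: ltW. Qed.
Let L2_gt0 : 0 < L2 := L2_gt0 A.
Let L2_ge0 : 0 <= L2. Proof. exact: ltW. Qed.
Let q1_gt0 : 0 < q + 1. Proof. by rewrite ltr_wpDl. Qed.
Let q2_gt0 : 0 < q + 2. Proof. by rewrite ltr_wpDl. Qed.
Let sbar_gt0 : 0 < sbar.
Proof. by apply: lt_trans sbar_gt; rewrite divr_gt0 // mulr_gt0. Qed.
Let sigma_gt0 : 0 < sigma. Proof. exact: lt_le_trans sigma_ge. Qed.
Let r_ge0 : 0 <= r := enorm_ge0 s.

Lemma sublevel_interior : interior F x.
Proof. exact: (sublevel_sub_F A). Qed.

Let Fx : F x. Proof. exact: interior_subset sublevel_interior. Qed.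

Let s_min v : dot (grad f x) s + 2^-1 * dot (s *m hess f x) s
    + sigma / ((q + 1) * (q + 2)) * enorm s `^ (q + 2) <=
  dot (grad f x) v + 2^-1 * dot (v *m hess f x) v
    + sigma / ((q + 1) * (q + 2)) * enorm v `^ (q + 2).
Proof.
have [_ /(_ (v + x) I)] := y_argmin; rewrite /model addrK -/s.
lra.
Qed.

Lemma step_stationary :
  grad f x + s *m hess f x + (sigma / (q + 1) * r `^ q) *: s = 0.
Proof.
have c0 : 0 <= sigma / ((q + 1) * (q + 2)) by rewrite divr_ge0 ?mulr_ge0 // ltW.
have := @model_min_stationary R m (grad f x) (hess f x) _ q s q_ge0 c0 _ s_min.
have -> : sigma / ((q + 1) * (q + 2)) * (q + 2) = sigma / (q + 1).
  by field; rewrite !gt_eqF.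
apply=> h k.
exact: hess_sym (f_C2 A) (F_convex A) q_gt0 L2_ge0 (hess_holder A) _ _ _ sublevel_interior.
Qed.

Lemma step_linear_le0 : dot (grad f x) s <= 0.
Proof. exact: model_min_linear_le0 s_min. Qed.

Lemma powR_addr2 (a : R) : 0 <= a -> a `^ (q + 2) = a `^ q * a * a.
Proof.
move=> a0; have -> : q + 2 = q + 1 + 1 by ring.
by rewrite !powR_addr1 // addr_ge0.
Qed.

(** The stationarity equation paired with [s]. *)
Lemma step_linearE : dot (grad f x) s =
  - dot (s *m hess f x) s - sigma / (q + 1) * r `^ (q + 2).
Proof.
have := congr1 (fun v => dot v s) step_stationary.
rewrite !dotDl dotZl -enorm_sqr -/r dot0l powR_addr2 //.
by move: (dot _ _) (dot _ _) => a b; lra.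
Qed.

Lemma decrease_constant_gt0 : 0 < decrease_constant q L2 sbar.
Proof.
apply: divr_gt0; last by rewrite !mulr_gt0.
by rewrite subr_gt0 (mulrC _ sbar) -ltr_pdivrMr.
Qed.

(** The whole step decreases [f], as long as it stays where the Hessian is
    Hoelder: since [t <= 1], [t ^ (q + 2) <= t ^ 2], and the curvature along
    the step is bounded below by [step_linear_le0]. *)
Lemma step_descent_line t : 0 <= t <= 1 -> F (x + t *: s) ->
  f (x + t *: s) <= f x - t ^+ 2 * (decrease_constant q L2 sbar * r `^ (q + 2)).
Proof.
move=> /andP[t0 t1] Ft.
have := fun_taylor (f_C2 A) (F_convex A) q_ge0 L2_ge0 (hess_holder A) _ _ Fx Ft.
have -> : x + t *: s - x = t *: s by rewrite addrC addKr.
rewrite dotZr -scalemxAl dotZl dotZr enormZ (ger0_norm t0).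
rewrite (powRM _ t0 (enorm_ge0 _)) -/r (powR_addr2 t) // step_linearE.
rewrite ler_norml => /andP[_].
have := step_linear_le0; rewrite step_linearE.
have tq : t `^ q <= 1.
  have [->|tn0] := eqVneq t 0; first by rewrite powR0 // gt_eqF.
  rewrite -(powRr0 t); apply: ger_powR => //.
  by rewrite lt_def tn0 t0 t1.
have -> : decrease_constant q L2 sbar =
    2^-1 * (sbar / (q + 1)) - L2 / ((q + 1) * (q + 2)).
  by rewrite /decrease_constant; field; rewrite !gt_eqF.
have : sbar / (q + 1) <= sigma / (q + 1) by rewrite ler_pM2r ?invr_gt0.
have : 0 <= L2 / ((q + 1) * (q + 2)) by rewrite divr_ge0 ?mulr_ge0 // ltW.
move: (dot _ _) (r `^ (q + 2)) (powR_ge0 r (q + 2)) => Q rp rp0.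
move: (sigma / _) (sbar / _) (L2 / _) => a a' b b0 aa' curv taylor.
have h1 : b * (t `^ q * (t * t * rp)) <= b * (1 * (t * t * rp)).
  by rewrite ler_wpM2l // ler_wpM2r // !mulr_ge0.
have h2 : (t - 2^-1 * (t * t)) * (- Q - a * rp) <= 0.
  by rewrite mulr_ge0_le0 //; nra.
have h3 : a' * (t * t * rp) <= a * (t * t * rp).
  by rewrite ler_wpM2r // !mulr_ge0.
lra.
Qed.

(** While the segment from [x] to [y] is in [F], [f] stays below [f x0] on it,
    and that sublevel set is interior to [F]: the segment cannot leave [F]. *)
Lemma step_in_F : F y.
Proof.
have := segment_sub_closed F x s (F_closed A) Fx _ 1.
rewrite scale1r subrKC; apply; last by rewrite ler01 lexx.
move=> t t01 Ft; apply: (sublevel_sub_F A); rewrite /sublevel /=.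
apply: le_trans (step_descent_line t t01 Ft) _; apply: le_trans x_sublevel.
rewrite gerBl mulr_ge0 ?sqr_ge0 // mulr_ge0 ?powR_ge0 //.
exact: ltW decrease_constant_gt0.
Qed.

Lemma step_descent : f y <= f x - decrease_constant q L2 sbar * r `^ (q + 2).
Proof.
have := @step_descent_line 1; rewrite ler01 lexx scale1r subrKC expr1n mul1r.
by apply=> //; exact: step_in_F.
Qed.

(** By stationarity the new gradient is the Taylor error minus the force of the
    regularizer, and both are of order [r ^ (q + 1)]. *)
Lemma step_grad : sigma <= 2 * L2 ->
  enorm (grad f y) <= 3 * L2 / (q + 1) * r `^ (q + 1).
Proof.
move=> sigma_le.
have T := grad_taylor (f_C2 A) (F_convex A) q_ge0 L2_ge0 (hess_holder A) _ _ Fx step_in_F.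
have -> : grad f y = (grad f y - grad f x - s *m hess f x)
    - (sigma / (q + 1) * r `^ q) *: s.
  by rewrite -[LHS]addr0 -oppr0 -step_stationary !opprD !addrA.
apply: le_trans (enormD _ _) _; rewrite enormN enormZ ger0_norm; last first.
  by rewrite mulr_ge0 ?powR_ge0 // divr_ge0 // ltW.
have -> : sigma / (q + 1) * r `^ q * enorm s = sigma / (q + 1) * r `^ (q + 1).
  by rewrite powR_addr1 // mulrA.
apply: le_trans (lerD T (lexx _)) _; rewrite -/s -/r -mulrDl.
apply: ler_wpM2r; first exact: powR_ge0.
by rewrite -mulrDl ler_wpM2r ?invr_ge0 ?(ltW q1_gt0) //; lra.
Qed.

End OneStep.

(** * The step is controlled by the distance to the stationary set *)

(** In terms of [t = r / rho], the hypothesis says that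
    [sbar t^(q+1) - 2 sbar t^q - L2 (q+1) t - L2 <= 0]; divided by [t] this
    expression increases for [t > 2], so it is positive beyond its root [ell]. *)
Lemma le_ell_of_ineq {R : realType} (q L2 sbar sigma ell r rho : R) :
  0 < q -> 0 < L2 -> 0 < sbar -> sbar <= sigma ->
  0 < ell -> ell_eq q L2 sbar ell -> 0 <= r -> 0 <= rho ->
  sigma * r `^ q * (r - 2 * rho) <=
    L2 * rho `^ (q + 1) + (q + 1) * L2 * rho `^ q * r ->
  r <= ell * rho.
Proof.
move=> q0 L0 sb0 sbs ell0 hell r0 rho0; rewrite powR_addr1 ?(ltW q0) // => ineq.
have s0 : 0 < sigma by exact: lt_le_trans sbs.
rewrite leNgt; apply/negP => r_gt.
have rp : 0 < r by apply: le_lt_trans r_gt; rewrite mulr_ge0 // ltW.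
have Rq : 0 < r `^ q by exact: powR_gt0.
(* At distance 0 the inequality forces a null step. *)
have [rho_eq0|rho_neq0] := eqVneq rho 0.
  move: ineq; rewrite rho_eq0 powR0 ?gt_eqF // !(mulr0, mul0r, addr0, subr0).
  by rewrite leNgt !mulr_gt0.
have rhop : 0 < rho by rewrite lt_def rho_neq0.
have Pp : 0 < rho `^ q by exact: powR_gt0.
set a := ell * rho in r_gt.
have ap : 0 < a by exact: mulr_gt0.
have Ap : 0 < a `^ q by exact: powR_gt0.
have Aq : a `^ q <= r `^ q by apply: ge0_ler_powR; rewrite ?nnegrE // ?ltW.
have E : sbar * a `^ q * (a - 2 * rho) =
    L2 * (rho `^ q * rho) + (q + 1) * L2 * rho `^ q * a.
  move: hell; rewrite /ell_eq /a powR_addr1 ?ltW // powRM ?ltW // => hell.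
  have := congr1 (fun v => v * (rho `^ q * rho)) hell; rewrite mul0r.
  by move: (ell `^ q) (rho `^ q) => X Y h; lra.
have a2 : 0 < a - 2 * rho.
  have sA : 0 < sbar * a `^ q by exact: mulr_gt0.
  rewrite -(pmulr_rgt0 _ sA) E.
  have q1 : 0 < q + 1 by exact: addr_gt0.
  by rewrite addr_gt0 // !mulr_gt0.
have r2 : 0 < r - 2 * rho by lra.
have h1 : sbar * a `^ q * (r - 2 * rho) <= sigma * r `^ q * (r - 2 * rho).
  by apply: ler_wpM2r; rewrite ?(ltW r2) // ler_pM // ?ltW.
have h2 := ler_wpM2r (ltW ap) (le_trans h1 ineq).
have h3 := congr1 (fun v => v * r) E; rewrite /= in h3.
have h4 : 0 <= sbar * a `^ q * (rho * (r - a)).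
  by rewrite !mulr_ge0 // ?ltW // subr_gt0.
have h5 : 0 < L2 * (rho `^ q * rho) * (r - a).
  by rewrite !mulr_gt0 // subr_gt0.
move: h2 h3 h4 h5; clear -q0.
move: (a `^ q) (rho `^ q) => X Y; lra.
Qed.

(** Here [d1 >= 0] is the Hessian term that is discarded, [W = |w|], [p = |x - z|]
    and [E] bounds the error. *)
Fact pairing_alg {R : realType} (b W p E N d1 d2 d3 : R) :
  d1 + b * (W ^+ 2 - d2) = - d3 -> 0 <= d1 -> - N <= d3 ->
  b * d2 <= b * (p * W) -> N <= E * W -> b * (W - p) * W <= E * W.
Proof. by lra. Qed.

Section StepDistance.
Context {R : realType} {m : nat}.
Context {f : 'rV[R]_m -> R} {F : set 'rV[R]_m} {x0 : 'rV[R]_m}.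
Context {q L1 L2 sbar sigma ell : R} {x y : 'rV[R]_m}.
Hypothesis A : assumptionA f F x0 q L1 L2.
Hypothesis sbar_gt : 2 * L2 / (q + 2) < sbar.
Hypothesis sigma_ge : sbar <= sigma.
Hypothesis x_sublevel : f x <= f x0.
Hypothesis y_argmin : argmin (model f q sigma x) setT y.
Hypothesis ell_gt0 : 0 < ell.
Hypothesis ell_root : ell_eq q L2 sbar ell.

(** With [z] stationary, [w = y - z] solves
    [w H(z) + sigma/(q+1) r^q (y - x) = error]; pairing with [w] discards the
    positive semidefinite term and leaves the inequality of
    [le_ell_of_ineq]. *)
Lemma step_le_dist z : F z -> second_order_stationary f z ->
  enorm (y - x) <= ell * enorm (x - z).
Proof.
move=> Fz [gz Hz].
have q_gt0 := q_gt0 A; have L2_gt0 := L2_gt0 A.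
have q1_gt0 : 0 < q + 1 by exact: addr_gt0.
have sbar_gt0 : 0 < sbar.
  by apply: lt_trans sbar_gt; rewrite divr_gt0 ?mulr_gt0 ?addr_gt0.
have Fx := interior_subset (sublevel_interior A x_sublevel).
have stat := step_stationary A sbar_gt sigma_ge x_sublevel y_argmin.
move: stat; set s := y - x; set u := x - z; set r := enorm s; set rho := enorm u.
set a := sigma / (q + 1) * r `^ q => stat.
have a0 : 0 <= a.
  by rewrite mulr_ge0 ?powR_ge0 // divr_ge0 ?addr_ge0 ?ltW // (lt_le_trans sbar_gt0).
pose w := s + u.
pose e1 := grad f x - grad f z - u *m hess f z.
pose e2 := s *m (hess f x - hess f z).
have e1_le : enorm e1 <= L2 / (q + 1) * rho `^ (q + 1).
  exact: (grad_taylor (f_C2 A) (F_convex A) (ltW q_gt0) (ltW L2_gt0)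
    (hess_holder A) _ _ Fz Fx).
have e2_le : enorm e2 <= L2 * rho `^ q * r.
  exact: (enorm_hess_diff (hess_holder A) _ _ _ Fx Fz).
have alg (p1 p2 p3 p4 : 'rV[R]_m) :
    p2 + p3 + p4 = - (- p1 - p4 - p3 + (p1 - p2)).
  by apply/rowP => i; rewrite !mxE; ring.
have wE : w *m hess f z + a *: s = - (e1 + e2).
  rewrite /w /e1 /e2 gz subr0 mulmxDl mulmxBr.
  have -> : grad f x = - (s *m hess f x) - a *: s.
    by apply/eqP; rewrite -subr_eq0 !opprD !opprK addrA stat.
  exact: alg.
have := congr1 (fun v => dot v w) wE.
rewrite dotDl dotNl dotZl => eqw.
have sw : dot s w = enorm w ^+ 2 - dot u w.
  by rewrite enorm_sqr {2}/w dotDl addrK.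
have := cauchy_schwarz_norm (e1 + e2) w; rewrite ler_norml => /andP[ew _].
have uw := cauchy_schwarz u w.
have ee := enormD e1 e2.
have Hw := Hz w.
have rw : r <= enorm w + rho.
  by have := enormD w (- u); rewrite enormN addrK.
apply: (@le_ell_of_ineq R q L2 sbar sigma) => //; try exact: enorm_ge0.
have W0 := enorm_ge0 w; have r0 : 0 <= r := enorm_ge0 s.
have rho0 : 0 <= rho := enorm_ge0 u.
rewrite -/r -/rho.
have E0 : 0 <= L2 * rho `^ (q + 1) + (q + 1) * L2 * rho `^ q * r.
  have c0 : 0 <= (q + 1) * L2 := mulr_ge0 (ltW q1_gt0) (ltW L2_gt0).
  apply: addr_ge0; first exact: mulr_ge0 (ltW L2_gt0) (powR_ge0 _ _).
  exact: mulr_ge0 (mulr_ge0 c0 (powR_ge0 _ _)) r0.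
have aE : sigma * r `^ q = (q + 1) * a.
  by rewrite /a; field; rewrite gt_eqF.
(* If [y = z], the step has length [rho] and the left-hand side is at most 0. *)
have [w0|w_neq0] := eqVneq (enorm w) 0.
  apply: le_trans E0; rewrite aE mulr_ge0_le0 ?(mulr_ge0 (ltW q1_gt0) a0) //.
  by rewrite subr_le0 (le_trans rw) // w0 add0r mulr_natl mulr2n lerDl.
have Wp : 0 < enorm w by rewrite lt_def w_neq0.
have main : a * (enorm w - rho) <= L2 / (q + 1) * rho `^ (q + 1) + L2 * rho `^ q * r.
  rewrite -(ler_pM2r Wp).
  have h1 : a * dot u w <= a * (rho * enorm w) by exact: (ler_wpM2l a0 uw).
  have h2 : (enorm (e1 + e2)) * enorm w <=
      (L2 / (q + 1) * rho `^ (q + 1) + L2 * rho `^ q * r) * enorm w.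
    exact: (ler_wpM2r W0 (le_trans ee (lerD e1_le e2_le))).
  rewrite sw in eqw.
  exact: pairing_alg eqw Hw ew h1 h2.
have h3 : a * (r - 2 * rho) <= a * (enorm w - rho).
  apply: (ler_wpM2l a0); rewrite mulr_natl mulr2n opprD addrA.
  by rewrite lerD2r lerBlDr.
have h4 : (q + 1) * (a * (r - 2 * rho)) <=
    (q + 1) * (L2 / (q + 1) * rho `^ (q + 1) + L2 * rho `^ q * r).
  exact: (ler_wpM2l (ltW q1_gt0) (le_trans h3 main)).
have L2E : (q + 1) * (L2 / (q + 1)) = L2 by field; rewrite gt_eqF.
by rewrite aE -mulrA (le_trans h4) // mulrDr [X in X + _]mulrA L2E !mulrA.
Qed.

End StepDistance.

(** * Sequences and accumulation points *)

Section SequenceLemmas.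
Context {R : realType}.

Lemma cvg0_powR (u : nat -> R) (e : R) : 0 < e -> (forall n, 0 <= u n) ->
  u n @[n --> \oo] --> 0 -> u n `^ e @[n --> \oo] --> (0 : R).
Proof.
move=> e0 u0 ucvg; apply/cvgr0Pnorm_lt => eps eps0.
have eps1 : 0 < eps `^ e^-1 by exact: powR_gt0.
near=> n; rewrite ger0_norm ?powR_ge0 //.
have -> : eps = (eps `^ e^-1) `^ e.
  by rewrite -powRrM mulVf ?gt_eqF // powRr1 // ltW.
apply: gt0_ltr_powR; rewrite // ?nnegrE ?powR_ge0 //.
rewrite -[ltLHS](ger0_norm (u0 n)); near: n.
by move/cvgr0Pnorm_lt : ucvg; apply.
Unshelve. all: by end_near. Qed.

(** An accumulation point inherits inequalities that hold along the sequence
    up to a vanishing error. *)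
Lemma cluster_ge0 {T : topologicalType} (x : nat -> T) (xbar : T) (h : T -> R)
    (a : nat -> R) :
  cluster (x k @[k --> \oo]) xbar -> {for xbar, continuous h} ->
  a k @[k --> \oo] --> 0 -> (forall k, - a k <= h (x k)) -> 0 <= h xbar.
Proof.
move=> xcl hcont acvg ha; rewrite leNgt; apply/negP => h_lt0.
have near_x : \forall y \near xbar, h y < h xbar / 2.
  by apply: (cvgr_lt _ hcont); lra.
have near_a : \forall k \near \oo, a k < - (h xbar / 2).
  by apply: (cvgr_lt _ acvg); lra.
have near_xa : (x k @[k --> \oo]) (x @` [set k | a k < - (h xbar / 2)]).
  by apply: filterS near_a => k ak; exists k.
have [_ [/= [k ak <-] hk]] := xcl _ _ near_xa near_x.
by have := ha k; lra.
Qed.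

Lemma nonincreasing_increment_cvg0 (u : nat -> R) (b : R) :
  (forall n, u n.+1 <= u n) -> (forall n, b <= u n) ->
  u n - u n.+1 @[n --> \oo] --> (0 : R).
Proof.
move=> u_dec u_ge.
have ucvg : cvgn u.
  apply: nonincreasing_is_cvgn; first exact/nonincreasing_seqP.
  by exists b => _ [n _ <-].
by rewrite -(subrr (limn u)); apply: cvgB => //; rewrite cvg_shiftS.
Qed.

End SequenceLemmas.

(** * The whole run *)

(** [gs] and [gv] are the linear terms, [Q] and [Qv] the quadratic terms of the
    model at its minimizer and at a competitor [v]. *)
Fact curvature_alg {R : realType}
    (fx gs Q b N gv Qv e c V D L G r r' : R) :
  gs = - Q - b * D ->
  fx + gs + 2^-1 * Q + e * N <= fx + gv + 2^-1 * Qv + c * V ->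
  gv <= G -> - r <= gs -> c * V <= L -> b * D <= 2 * r' -> 0 <= e * N ->
  - (G + (2^-1 * r + r')) <= 2^-1 * Qv + L.
Proof. by lra. Qed.

Fact rescale_alg {R : realType} (t T Q c N : R) : 0 < t ->
  0 <= 2^-1 * (t * (t * Q)) + c * (T * t * t * N) -> - Q <= 2 * (c * N) * T.
Proof.
by move=> t0 h; rewrite -(@ler_pM2r _ (t ^+ 2)) ?exprn_gt0 //; lra.
Qed.

Section Run.
Context {R : realType} {m : nat}.
Context {f : 'rV[R]_m -> R} {F : set 'rV[R]_m} {x0 : 'rV[R]_m}.
Context {q L1 L2 sbar zeta : R}.
Context {sigma : nat -> R} {xhat xtil x : nat -> 'rV[R]_m}.
Hypothesis A : assumptionA f F x0 q L1 L2.
Hypothesis sbar_gt : 2 * L2 / (q + 2) < sbar.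
Hypothesis zeta_range : 0 <= zeta < 1.
Hypothesis run : algorithm1_run f q L2 sbar zeta x0 sigma xhat xtil x.

Let q_gt0 : 0 < q := q_gt0 A.
Let L1_gt0 : 0 < L1 := L1_gt0 A.
Let L2_gt0 : 0 < L2 := L2_gt0 A.
Let q1_gt0 : 0 < q + 1. Proof. exact: addr_gt0. Qed.
Let q2_gt0 : 0 < q + 2. Proof. exact: addr_gt0. Qed.
Let zeta_ge0 : 0 <= zeta. Proof. by case/andP: zeta_range. Qed.
Let zeta_lt1 : 0 < 1 - zeta.
Proof. by case/andP: zeta_range; rewrite subr_gt0. Qed.

Let sigma_ge k : sbar <= sigma k.
Proof. by case/andP: (run_sigma run k). Qed.
Let sigma_le k : sigma k <= 2 * L2.
Proof. by case/andP: (run_sigma run k). Qed.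

Let d k := enorm (xhat k.+1 - x k).
Let d_ge0 k : 0 <= d k. Proof. exact: enorm_ge0. Qed.
Let D := decrease_constant q L2 sbar.
Let D_gt0 : 0 < D. Proof. exact: (decrease_constant_gt0 A sbar_gt). Qed.
Let gap := f x0 - inf (range f).
Let gam := gamma q L2 sbar zeta gap.

Let beta k := Num.min zeta
  (Num.min (enorm (grad f (xhat k.+1))) (enorm (xhat k.+1 - x k))).

Let beta_ge0 k : 0 <= beta k.
Proof. by rewrite /beta !le_min zeta_ge0 !enorm_ge0. Qed.
Let beta_le_zeta k : beta k <= zeta.
Proof. by rewrite /beta ge_min lexx. Qed.
Let beta_le_grad k : beta k <= enorm (grad f (xhat k.+1)).
Proof. by rewrite /beta !ge_min lexx !orbT. Qed.
Let beta_le_d k : beta k <= d k.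
Proof. by rewrite /beta !ge_min lexx !orbT. Qed.

Lemma run_best k : f (x k.+1) <= f (xhat k.+1).
Proof. by have [_ /(_ (xhat k.+1))] := run_x run k; apply; left. Qed.

Lemma run_momentum k :
  enorm (x k.+1 - xhat k.+1) <= beta k * enorm (xhat k.+1 - xhat k).
Proof.
have [[->|->] _] := run_x run k.
  by rewrite subrr enorm0 mulr_ge0 // enorm_ge0.
by rewrite (run_xtil run) addrC addKr enormZ ger0_norm // beta_ge0.
Qed.

Let descent k : f (x k) <= f x0 ->
  f (xhat k.+1) <= f (x k) - D * d k `^ (q + 2).
Proof.
move=> xk; exact: (step_descent A sbar_gt (sigma_ge k) xk
  (run_xhat run k)).
Qed.

Let D_term_ge0 k : 0 <= D * d k `^ (q + 2).
Proof. exact: mulr_ge0 (ltW D_gt0) (powR_ge0 _ _). Qed.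

Lemma run_sublevel k : f (x k) <= f x0.
Proof.
elim: k => [|k IH]; first by rewrite (run_x0 run).
apply: le_trans (run_best k) (le_trans (descent k IH) _).
by apply: le_trans IH; rewrite gerBl.
Qed.

Lemma run_descent k : f (x k.+1) <= f (x k) - D * d k `^ (q + 2).
Proof. exact: le_trans (run_best k) (descent k (run_sublevel k)). Qed.

Lemma run_interior k : interior F (x k).
Proof. exact: (sublevel_sub_F A (run_sublevel k)). Qed.

Lemma run_F k : F (x k).
Proof. exact: interior_subset (run_interior k). Qed.

Lemma run_hat_F k : F (xhat k.+1).
Proof.
exact: (step_in_F A sbar_gt (sigma_ge k) (run_sublevel k)
  (run_xhat run k)).
Qed.

Let f_ge y : inf (range f) <= f y.
Proof. by apply: ge_inf; [exact: f_bounded_below A|exists y]. Qed.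

(** A single decrease cannot exceed the total decrease [f x0 - inf f]; [gamma]
    is the resulting bound on the step divided by [1 - zeta]. *)
Lemma run_step_bounded k : d k <= (1 - zeta) * gam.
Proof.
rewrite /gam /gamma mulrA mulfV ?gt_eqF // mul1r.
have DE : 2 * (q + 1) * (q + 2) / ((q + 2) * sbar - 2 * L2) = D^-1.
  by rewrite /D /decrease_constant invf_div.
have Dd : D * d k `^ (q + 2) <= gap.
  rewrite lerBrDr; apply: le_trans (lerD (lexx _) (f_ge (x k.+1))) _.
  apply: le_trans (lerD (lexx _) (run_descent k)) _.
  by rewrite addrC subrK run_sublevel.
rewrite DE; have -> : d k = (d k `^ (q + 2)) `^ (q + 2)^-1.
  by rewrite -powRrM mulfV ?gt_eqF // powRr1.
have gap0 : 0 <= gap by exact: le_trans (D_term_ge0 k) Dd.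
apply: ge0_ler_powR; rewrite ?nnegrE ?powR_ge0 ?invr_ge0 ?(ltW q2_gt0) //.
  by rewrite mulr_ge0 // invr_ge0 ltW.
by rewrite mulrC ler_pdivlMr // mulrC.
Qed.

(** By induction: the step contributes [(1 - zeta) * gam] and the momentum, of
    relative size at most [zeta], contributes [zeta * gam]. *)
Lemma run_hat_step_bounded k : enorm (xhat k.+1 - xhat k) <= gam.
Proof.
have gam0 : 0 <= gam.
  by rewrite mulr_ge0 ?powR_ge0 // invr_ge0 ltW.
elim: k => [|k IH].
  have := run_step_bounded 0; rewrite /d (run_x0 run) (run_xhat0 run) => h.
  by apply: le_trans h _; rewrite mulrBl mul1r gerBl mulr_ge0.
apply: le_trans (enorm_triangle (x k.+1) _ _) _.
apply: le_trans (lerD (run_step_bounded k.+1) (run_momentum k)) _.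
have : beta k * enorm (xhat k.+1 - xhat k) <= zeta * gam.
  by apply: ler_pM; rewrite ?enorm_ge0 ?beta_ge0.
by rewrite mulrBl mul1r; lra.
Qed.

Lemma gam_ge0 : 0 <= gam.
Proof. exact: le_trans (enorm_ge0 _) (run_hat_step_bounded 0). Qed.

(** The momentum coefficient is at most the norm of the gradient at
    [xhat k.+1], so the extrapolation changes the gradient by at most
    [gam * L1] times that norm. *)
Lemma run_grad_le k : enorm (grad f (x k.+1)) <=
  (1 + gam * L1) * (3 * L2 / (q + 1)) * d k `^ (q + 1).
Proof.
have hat_le : enorm (grad f (xhat k.+1)) <= 3 * L2 / (q + 1) * d k `^ (q + 1).
  exact: (step_grad A sbar_gt (sigma_ge k)
    (run_sublevel k) (run_xhat run k) (sigma_le k)).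
rewrite -mulrA.
have c0 : 0 <= 1 + gam * L1.
  exact: addr_ge0 ler01 (mulr_ge0 gam_ge0 (ltW L1_gt0)).
apply: le_trans (ler_wpM2l c0 hat_le).
apply: le_trans (enorm_le_sub _ (grad f (xhat k.+1))) _.
rewrite mulrDl mul1r addrC lerD2l.
apply: le_trans (grad_lipschitz A (run_F k.+1) (run_hat_F k)) _.
rewrite (mulrC gam) -mulrA; apply: (ler_wpM2l (ltW L1_gt0)).
apply: le_trans (run_momentum k) _; rewrite mulrC.
exact: ler_pM (enorm_ge0 _) (beta_ge0 k) (run_hat_step_bounded k) (beta_le_grad k).
Qed.

(** The momentum coefficient is also at most the length of the step. *)
Lemma run_step_le k : enorm (x k.+1 - x k) <= (1 + gam) * d k.
Proof.
apply: le_trans (enorm_triangle (xhat k.+1) _ _) _.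
rewrite mulrDl mul1r addrC lerD2l; apply: le_trans (run_momentum k) _.
rewrite mulrC.
exact: ler_pM (enorm_ge0 _) (beta_ge0 k) (run_hat_step_bounded k) (beta_le_d k).
Qed.

Lemma run_d_powR_cvg0 : d k `^ (q + 2) @[k --> \oo] --> (0 : R).
Proof.
have inc_cvg : f (x k) - f (x k.+1) @[k --> \oo] --> (0 : R).
  apply: (@nonincreasing_increment_cvg0 _ (f \o x) (inf (range f))) => k.
    by apply: le_trans (run_descent k) _; rewrite gerBl.
  exact: f_ge.
have zero_cvg : (fun _ : nat => 0 : R) @ \oo --> (0 : R) by exact: cvg_cst.
have up_cvg : D^-1 * (f (x k) - f (x k.+1)) @[k --> \oo] --> (0 : R).
  by rewrite -[X in _ --> X](mulr0 D^-1); apply: cvgM => //; exact: cvg_cst.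
apply: (squeeze_cvgr _ zero_cvg up_cvg); near=> k.
rewrite powR_ge0 mulrC ler_pdivlMr // mulrC /=.
by have := run_descent k; lra.
Unshelve. all: by end_near. Qed.

Lemma run_d_cvg0 : d k @[k --> \oo] --> (0 : R).
Proof.
have -> : d = (fun k => (d k `^ (q + 2)) `^ (q + 2)^-1).
  by apply/funext => k; rewrite -powRrM mulfV ?gt_eqF // powRr1.
by apply: cvg0_powR run_d_powR_cvg0; rewrite ?invr_gt0 // => k; exact: powR_ge0.
Qed.

Lemma run_grad_cvg0 : enorm (grad f (x k)) @[k --> \oo] --> (0 : R).
Proof.
rewrite -(cvg_shiftS (fun k => enorm (grad f (x k)))).
have zero_cvg : (fun _ : nat => 0 : R) @ \oo --> (0 : R) by exact: cvg_cst.
set C := (1 + gam * L1) * (3 * L2 / (q + 1)).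
have up_cvg : C * d k `^ (q + 1) @[k --> \oo] --> (0 : R).
  rewrite -[X in _ --> X](mulr0 C); apply: cvgM; first exact: cvg_cst.
  exact: cvg0_powR run_d_cvg0.
apply: (squeeze_cvgr _ zero_cvg up_cvg); near=> k.
by rewrite enorm_ge0 run_grad_le.
Unshelve. all: by end_near. Qed.

(** Comparing the model at an arbitrary displacement with its minimum, whose
    value is of the order of the gradient and the step. *)
Lemma run_curvature_ge k v :
  - (enorm (grad f (x k)) * enorm v + (2^-1 * (enorm (grad f (x k)) * d k) +
      L2 / (q + 1) * d k `^ (q + 2))) <=
  2^-1 * dot (v *m hess f (x k)) v +
    2 * L2 / ((q + 1) * (q + 2)) * enorm v `^ (q + 2).
Proof.
have [_ /(_ (v + x k) I)] := run_xhat run k; rewrite /model addrK.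
have := step_linearE A sbar_gt (sigma_ge k)
  (run_sublevel k) (run_xhat run k).
set s := xhat k.+1 - x k => lin le_v.
have gv := cauchy_schwarz (grad f (x k)) v.
have gs := cauchy_schwarz_norm (grad f (x k)) s.
rewrite ler_norml -/(d k) in gs; case/andP: gs => gs _.
have sV : sigma k / ((q + 1) * (q + 2)) * enorm v `^ (q + 2) <=
    2 * L2 / ((q + 1) * (q + 2)) * enorm v `^ (q + 2).
  apply: (ler_wpM2r (powR_ge0 _ _)).
  by rewrite ler_pM2r ?invr_gt0 ?mulr_gt0.
have sD : sigma k / (q + 1) * d k `^ (q + 2) <=
    2 * (L2 / (q + 1) * d k `^ (q + 2)).
  rewrite mulrA [2 * _]mulrA; apply: (ler_wpM2r (powR_ge0 _ _)).
  by rewrite ler_pM2r ?invr_gt0.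
have s0 : 0 <= sigma k / ((q + 1) * (q + 2)) * enorm s `^ (q + 2).
  apply: mulr_ge0 (powR_ge0 _ _); apply: divr_ge0; last first.
    by rewrite mulr_ge0 ?(ltW q1_gt0) ?(ltW q2_gt0).
  apply: le_trans (sigma_ge k); apply: le_trans (ltW sbar_gt).
  by rewrite divr_ge0 ?mulr_ge0 ?(ltW q2_gt0) ?(ltW L2_gt0).
exact: curvature_alg lin le_v gv gs sV sD s0.
Qed.

Context {xbar : 'rV[R]_m}.
Hypothesis xbar_cluster : cluster (x k @[k --> \oo]) xbar.

Lemma cluster_interior : interior F xbar.
Proof.
have [df _ _] := f_C2 A.
apply: (sublevel_sub_F A); rewrite /sublevel /= -subr_ge0.
apply: (cluster_ge0 _ _ (fun y => f x0 - f y) (fun=> 0) xbar_cluster).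
- apply: continuousB; first exact: cst_continuous.
  exact: differentiable_continuous.
- exact: cvg_cst.
- by move=> k; rewrite oppr0 subr_ge0 run_sublevel.
Qed.

Lemma cluster_grad_eq0 : grad f xbar = 0.
Proof.
have [_ dg _] := f_C2 A.
apply: enorm0_eq0; apply: le_anti; rewrite enorm_ge0 andbT -oppr_ge0.
apply: (cluster_ge0 _ _ (fun y => - enorm (grad f y)) _ xbar_cluster _
  run_grad_cvg0) => //.
apply: continuousN; apply: continuous_comp.
  exact: differentiable_continuous.
exact: continuous_enorm.
Qed.

Lemma cluster_psd : psd (hess f xbar).
Proof.
have [_ _ ch] := f_C2 A.
pose c := 2 * L2 / ((q + 1) * (q + 2)).
have curv v : 0 <= 2^-1 * dot (v *m hess f xbar) v + c * enorm v `^ (q + 2).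
  pose h y := 2^-1 * dot (v *m hess f y) v + c * enorm v `^ (q + 2).
  pose a k := enorm (grad f (x k)) * enorm v +
    (2^-1 * (enorm (grad f (x k)) * d k) + L2 / (q + 1) * d k `^ (q + 2)).
  apply: (cluster_ge0 _ _ h a xbar_cluster); last by move=> k; exact: run_curvature_ge.
    have quad_cont : {for xbar, continuous (fun y => dot (v *m hess f y) v)}.
      apply: (@continuous_comp _ _ _ (hess f) (fun B => dot (v *m B) v)).
        exact: ch.
      exact: continuous_quadratic_form.
    apply: (@continuousD _ _ _ (fun y => 2^-1 * dot (v *m hess f y) v)
      (fun=> c * enorm v `^ (q + 2))); last exact: cst_continuous.
    apply: (@continuousM _ _ (fun=> 2^-1) (fun y => dot (v *m hess f y) v)) => //.
    exact: cst_continuous.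
  have -> : (0 : R) = 0 * enorm v + (2^-1 * (0 * 0) + L2 / (q + 1) * 0) by ring.
  apply: cvgD; first by apply: cvgM; [exact: run_grad_cvg0|exact: cvg_cst].
  apply: cvgD; apply: cvgM; try exact: cvg_cst; last exact: run_d_powR_cvg0.
  by apply: cvgM; [exact: run_grad_cvg0|exact: run_d_cvg0].
(* Replacing [v] by [t v] makes the regularizer negligible against the
   quadratic form. *)
move=> v; rewrite -oppr_le0.
apply: (@le0_of_le_powR _ _ (2 * (c * enorm v `^ (q + 2))) q) => //.
near=> t.
have t0 : 0 < t by near: t; exact: nbhs_right_gt.
have := curv (t *: v); rewrite -scalemxAl dotZl dotZr enormZ gtr0_norm //.
rewrite (powRM _ (ltW t0) (enorm_ge0 _)).
have -> : t `^ (q + 2) = t `^ q * t * t.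
  have -> : q + 2 = q + 1 + 1 by ring.
  by rewrite !powR_addr1 ?(ltW t0) ?(ltW q_gt0) ?(ltW q1_gt0).
exact: rescale_alg t0.
Unshelve. all: by end_near. Qed.

Lemma cluster_stationary : second_order_stationary f xbar.
Proof. by split; [exact: cluster_grad_eq0|exact: cluster_psd]. Qed.

End Run.

(** * Trapping near the accumulation point *)

Section Trapping.
Context {R : realType} {m : nat}.
Context {x : nat -> 'rV[R]_m} {xbar : 'rV[R]_m} {rho : nat -> R}.
Context {C kappa radius : R}.
Hypothesis C_ge0 : 0 <= C.
Hypothesis kappa_ge0 : 0 <= kappa.
Hypothesis kappa_lt1 : kappa < 1.
Hypothesis radius_gt0 : 0 < radius.
Hypothesis xbar_cluster : cluster (x k @[k --> \oo]) xbar.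
Hypothesis rho_ge0 : forall k, 0 <= rho k.
Hypothesis rho_le : forall k, rho k <= enorm (x k - xbar).
Hypothesis short_step : forall k, enorm (x k - xbar) < radius ->
  enorm (x k.+1 - x k) <= C * rho k.
Hypothesis contraction : forall k, enorm (x k - xbar) < radius ->
  enorm (x k.+1 - xbar) < radius -> rho k.+1 <= kappa * rho k.

Let B := C / (1 - kappa).
Let kappa1 : 0 < 1 - kappa. Proof. by rewrite subr_gt0. Qed.
Let B_ge0 : 0 <= B. Proof. by rewrite divr_ge0 // ltW. Qed.
Let BE : B = C + kappa * B.
Proof. by rewrite /B; field; rewrite gt_eqF. Qed.

(** The distance to [xbar] plus the length [B * rho k] that a geometric
    sequence of steps could still cover. *)
Let Phi k := enorm (x k - xbar) + B * rho k.

Let dist_le_Phi k : enorm (x k - xbar) <= Phi k.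
Proof. by rewrite lerDl mulr_ge0. Qed.

(** The budget [B * rho k] pays for the next step and for the next budget, since
    [B = C + kappa * B]. *)
Lemma trapped_step k : Phi k < radius ->
  enorm (x k.+1 - x k) + B * rho k.+1 <= B * rho k /\ Phi k.+1 <= Phi k.
Proof.
move=> Phik; have xk := le_lt_trans (dist_le_Phi k) Phik.
have step := short_step k xk.
have tri := enorm_triangle (x k) (x k.+1) xbar.
have CB : C * rho k <= B * rho k.
  by apply: (ler_wpM2r (rho_ge0 k)); rewrite BE lerDl mulr_ge0.
have xk1 : enorm (x k.+1 - xbar) < radius.
  by move: Phik; rewrite /Phi; lra.
have Bk : B * rho k.+1 <= B * (kappa * rho k).
  exact: (ler_wpM2l B_ge0 (contraction k xk xk1)).
have BkE : B * rho k = C * rho k + B * (kappa * rho k).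
  by rewrite {1}BE; ring.
by split; rewrite ?/Phi; lra.
Qed.

Lemma trapped_Phi k j : Phi k < radius -> Phi (k + j) <= Phi k.
Proof.
move=> Phik; elim: j => [|j IH]; first by rewrite addn0.
rewrite addnS; have [_ h] := trapped_step _ (le_lt_trans IH Phik).
exact: le_trans h IH.
Qed.

(** The displacement since [k] has been paid for out of the budget
    [B * rho k]. *)
Lemma trapped_travel k j : Phi k < radius ->
  enorm (x (k + j)%N - x k) + B * rho (k + j)%N <= B * rho k.
Proof.
move=> Phik; elim: j => [|j IH]; first by rewrite addn0 subrr enorm0 add0r.
rewrite addnS.
have [h _] := trapped_step _ (le_lt_trans (trapped_Phi k j Phik) Phik).
by have := enorm_triangle (x (k + j)%N) (x (k + j).+1) (x k); lra.
Qed.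

Lemma cluster_enorm_lt eps : 0 < eps -> exists k, enorm (x k - xbar) < eps.
Proof.
move=> eps0.
have near_x : \forall y \near xbar, enorm (y - xbar) < eps.
  have cont : {for xbar, continuous (fun y : 'rV[R]_m => enorm (y - xbar))}.
    apply: (@continuous_comp _ _ _ (fun y : 'rV[R]_m => y - xbar) (@enorm R m)).
      apply: (@continuousB _ _ _ (fun y : 'rV[R]_m => y) (fun=> xbar));
        [by move=> P; exact|exact: cst_continuous].
    exact: continuous_enorm.
  by apply: (cvgr_lt (enorm (xbar - xbar)) cont); rewrite subrr enorm0.
have near_xa : (x k @[k --> \oo]) (range x).
  by exists 0%N => // k _; exists k.
by have [_ [[k _ <-] hk]] := xbar_cluster _ _ near_xa near_x; exists k.
Qed.

Lemma trap_entered eps : 0 < eps -> exists k, Phi k < eps.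
Proof.
move=> eps0; have B1 : 0 < 1 + B by rewrite ltr_wpDr.
have [k hk] := cluster_enorm_lt _ (divr_gt0 eps0 B1); exists k.
rewrite ltr_pdivlMr // in hk; apply: le_lt_trans hk.
by rewrite mulrDr mulr1 lerD2l mulrC; exact: (ler_wpM2r B_ge0 (rho_le k)).
Qed.

Lemma trapped_enorm_lt eps : 0 < eps ->
  exists K, forall k, (K <= k)%N -> enorm (x k - xbar) < eps.
Proof.
move=> eps0; have e0 : 0 < Num.min eps radius by rewrite lt_min eps0.
have [K] := trap_entered _ e0; rewrite lt_min => /andP[hK1 hK2].
exists K => k /subnKC <-; apply: le_lt_trans (dist_le_Phi _) _.
exact: le_lt_trans (trapped_Phi _ _ hK2) hK1.
Qed.

Lemma trapped_cvg : x k @[k --> \oo] --> xbar.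
Proof.
apply/cvgrPdist_lt => eps eps0; have [K hK] := trapped_enorm_lt _ eps0.
exists K => // k /= Kk; rewrite distrC.
exact: le_lt_trans (mxnorm_le_enorm _) (hK k Kk).
Qed.

Lemma trapped_rate : exists K, forall k, (K <= k)%N ->
  enorm (x k - xbar) < radius /\ enorm (x k - xbar) <= B * rho k.
Proof.
have [K PhiK] := trap_entered _ radius_gt0.
exists K => k /subnKC kE; have Phik : Phi k < radius.
  by rewrite -kE; exact: le_lt_trans (trapped_Phi _ _ PhiK) PhiK.
split; first exact: le_lt_trans (dist_le_Phi k) Phik.
apply/ler_addgt0Pr => eps eps0; have [J hJ] := trapped_enorm_lt _ eps0.
have := hJ (k + J)%N (leq_addl _ _); have := trapped_travel k J Phik.
have := enorm_triangle (x (k + J)%N) (x k) xbar.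
rewrite (enormC (x k) (x (k + J)%N)).
have := mulr_ge0 B_ge0 (rho_ge0 (k + J)%N).
lra.
Qed.

End Trapping.

(** * Generalized inverses and limits superior *)

Section InverseOfIncreasing.
Context {R : realType}.
Context {psi : R -> R}.
Hypothesis psi_adm : admissible psi.
Hypothesis psi_inc : increasing_nneg psi.

Let psi0 : psi 0 = 0. Proof. by case: psi_adm. Qed.

Lemma psi1_gt0 : 0 < psi 1.
Proof. by rewrite -{1}psi0; apply: psi_inc => //; exact: ltr01. Qed.

(** Below [psi 1] the supremum defining the inverse is over a bounded set. *)
Lemma inv_nneg_has_ubound s : s < psi 1 ->
  has_ubound [set t | 0 <= t /\ psi t <= s].
Proof.
move=> s1; exists 1 => t [t0 ts]; rewrite leNgt; apply/negP => t1.
have := psi_inc 1 t ler01 t1.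
by rewrite ltNge (le_trans ts) // ltW.
Qed.

Lemma le_inv_nneg s t : s < psi 1 -> 0 <= t -> psi t <= s ->
  t <= inv_nneg psi s.
Proof. by move=> s1 t0 ts; apply: (ub_le_sup (inv_nneg_has_ubound _ s1)). Qed.

Lemma inv_nneg_homo s s' : 0 <= s -> s <= s' -> s' < psi 1 ->
  inv_nneg psi s <= inv_nneg psi s'.
Proof.
move=> s0 ss' s1; apply: ge_sup; first by exists 0; rewrite /= psi0.
by move=> t [t0 ts]; apply: le_inv_nneg => //; exact: le_trans ss'.
Qed.

Lemma inv_nneg0 : inv_nneg psi 0 = 0.
Proof. by rewrite -[X in inv_nneg _ X]psi0 inv_nnegK. Qed.

End InverseOfIncreasing.

Section LimitSuperior.
Context {R : realType}.

Lemma limf_esup_right_lt1 (g : R -> R) :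
  (limf_esup (fun t : R => (g t / t)%:E) (0 : R)^'+ < 1%:E)%E ->
  exists kappa delta, [/\ 0 <= kappa, kappa < 1, 0 < delta &
    forall t, 0 < t < delta -> g t <= kappa * t].
Proof.
move=> /ereal_inf_lt[_ [V V0 <-]] supV.
have [delta delta0 Vdelta] : exists2 delta, 0 < delta &
    forall t, 0 < t < delta -> V t.
  move: V0 => /nbhs_ballP[e /= e0 Ve]; exists e => // t /andP[t0 te].
  by apply: Ve => //=; rewrite /ball /= sub0r normrN gtr0_norm.
have supP t : V t -> ((g t / t)%:E <= ereal_sup ((fun t => (g t / t)%:E) @` V))%E.
  by move=> Vt; apply: ereal_sup_ubound; exists t.
move: supV supP; case: (ereal_sup _) => [s| |] //.
- rewrite lte_fin => s1 supP; exists (Num.max 0 s), delta; split => //.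
  + by rewrite le_max lexx.
  + by rewrite gt_max ltr01.
  + move=> t tdelta; have := supP t (Vdelta t tdelta).
    case/andP: tdelta => t0 _; rewrite lee_fin ler_pdivrMr // => /le_trans; apply.
    by apply: (ler_wpM2r (ltW t0)); rewrite le_max lexx orbT.
- move=> _ supP; exists 0, delta; split => // t tdelta.
  by have := supP t (Vdelta t tdelta); rewrite leeNy_eq.
Qed.

(** A null denominator forces a null numerator, and then the quotient is
    [0 * +oo = 0]. *)
Lemma limn_esup_ratio_lty (a b : nat -> R) (B : R) (K : nat) :
  (forall n, (K <= n)%N -> [/\ 0 <= a n, 0 <= b n & a n <= B * b n]) -> 0 <= B ->
  (limn_esup (fun n => (a n)%:E / (b n)%:E) < +oo)%E.
Proof.
move=> ab B0.
apply: (@le_lt_trans _ _ (B%:E)); last exact: ltry.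
have KV : \oo%classic [set n | (K <= n)%N] by exists K.
apply: le_trans (ereal_inf_lbound _) _.
  by exists [set n | (K <= n)%N]; [exact: KV|reflexivity].
apply: ge_ereal_sup => _ [n /= Kn <-]; have [a0 b0 anb] := ab n Kn.
have [bn0|bn0] := eqVneq (b n) 0.
  have an0 : a n = 0 by apply: le_anti; rewrite a0 andbT -(mulr0 B) -bn0.
  by rewrite an0 mul0e lee_fin.
have bp : 0 < b n by rewrite lt_def bn0.
by rewrite inver (negbTE bn0) -EFinM lee_fin ler_pdivrMr.
Qed.

End LimitSuperior.

(** * Distances and the convergence theorem *)

Lemma powR_scale_near0 {R : realType} (c p b : R) : 0 <= c -> 0 < p -> 0 < b ->
  exists2 delta, 0 < delta & forall t, 0 <= t <= delta -> c * t `^ p < b.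
Proof.
move=> c0 p0 b0.
have lim : c * t `^ p @[t --> (0 : R)^'+] --> c * 0.
  by apply: cvgM; [exact: cvg_cst|exact: powR_cvg0].
have small : \forall t \near (0 : R)^'+, c * t `^ p < b.
  by apply: (cvgr_lt _ lim); rewrite mulr0.
near (0 : R)^'+ => delta; exists delta.
  by near: delta; exact: nbhs_right_gt.
move=> t /andP[t0 tdelta]; apply: (@le_lt_trans _ _ (c * delta `^ p)).
  apply: (ler_wpM2l c0); apply: ge0_ler_powR; rewrite ?nnegrE ?(ltW p0) //.
by near: delta; exact: small.
Unshelve. all: by end_near. Qed.

Lemma interior_enorm_ball {R : realType} {m : nat} (F : set 'rV[R]_m)
    (x : 'rV[R]_m) : interior F x ->
  exists2 e, 0 < e & forall y, enorm (y - x) < e -> F y.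
Proof.
move=> /nbhs_ballP[e /= e0 eF]; exists e => // y ye; apply: eF.
rewrite -ball_normE /= distrC.
exact: le_lt_trans (mxnorm_le_enorm _) ye.
Qed.

Section DistanceToSet.
Context {R : realType} {m : nat}.
Implicit Types (x z : 'rV[R]_m) (S : set 'rV[R]_m).

Lemma edist_set_le x z S : S z -> edist_set x S <= enorm (x - z).
Proof.
move=> Sz; apply: ge_inf; last by exists z.
by exists 0 => _ [y _ <-]; exact: enorm_ge0.
Qed.

Lemma le_edist_set x S z0 (c : R) : S z0 ->
  (forall z, S z -> c <= enorm (x - z)) -> c <= edist_set x S.
Proof.
move=> Sz0 cS; apply: lb_le_inf; first by exists (enorm (x - z0)), z0.
by move=> _ [y Sy <-]; exact: cS.
Qed.

Lemma edist_set_ge0 x S z0 : S z0 -> 0 <= edist_set x S.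
Proof. by move=> Sz0; apply: le_edist_set Sz0 _ => z _; exact: enorm_ge0. Qed.

End DistanceToSet.

Theorem theorem7p7 (R : realType) (m : nat)
  (f : 'rV[R]_m -> R) (F : set 'rV[R]_m) (x0 : 'rV[R]_m) (q L1 L2 : R)
  (hA : assumptionA f F x0 q L1 L2)
  (sbar zeta : R) (x : nat -> 'rV[R]_m)
  (hx : generated_by_algorithm1 f q L2 sbar zeta x0 x)
  (xbar : 'rV[R]_m)
  (hxbar : cluster (x k @[k --> \oo]) xbar)
  (hbdd : exists k0 : nat, bounded_set (sublevel f (f (x k0))))
  (psi : R -> R) (hpsi : admissible psi) (hpsi_inc : increasing_nneg psi)
  (eta : R) (heta : 0 < eta)
  (hreg : forall y : 'rV[R]_m, enorm (y - xbar) < eta ->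
    psi (edist_set y (second_order_stationary f)) <= enorm (grad f y))
  (ell : R) (hell_gt0 : 0 < ell) (hell : ell_eq q L2 sbar ell) :
  let gam := gamma q L2 sbar zeta (f x0 - inf (range f)) in
  let tau := tau psi q L1 L2 gam ell in
  (limf_esup (fun t : R => (tau t / t)%:E) (0 : R)^'+ < 1%:E)%E ->
  [/\ second_order_stationary f xbar,
      x k @[k --> \oo] --> xbar &
      (limn_esup (fun k : nat =>
         (enorm (x k.+1 - xbar))%:E / (tau (enorm (x k - xbar)))%:E) < +oo)%E].
Proof.
move=> gam tau hlim.
have [/andP[sbar_gt sbar_le] zeta_range [sigma [xhat [xtil run]]]] := hx.
have q_gt0 := q_gt0 hA; have L1_gt0 := L1_gt0 hA; have L2_gt0 := L2_gt0 hA.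
have q1_gt0 : 0 < q + 1 by exact: addr_gt0.
have stat := cluster_stationary hA sbar_gt zeta_range run hxbar.
pose Theta := second_order_stationary f; pose rho k := edist_set (x k) Theta.
have rho_ge0 k : 0 <= rho k by exact: edist_set_ge0 stat.
have rho_le k : rho k <= enorm (x k - xbar) by exact: edist_set_le.
have g0 : 0 <= gam := gam_ge0 hA sbar_gt zeta_range run.
pose c := 3 * (1 + gam * L1) * L2 * ell `^ (q + 1) / (q + 1).
have cE : c = (1 + gam * L1) * (3 * L2 / (q + 1)) * ell `^ (q + 1).
  by rewrite /c; move: (ell `^ _) => e; field; rewrite gt_eqF.
have c1_ge0 : 0 <= (1 + gam * L1) * (3 * L2 / (q + 1)).
  apply: mulr_ge0; first by rewrite addr_ge0 // mulr_ge0 // ltW.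
  by rewrite divr_ge0 // ?mulr_ge0 // ltW.
have c_ge0 : 0 <= c by rewrite cE; exact: mulr_ge0 c1_ge0 (powR_ge0 _ _).
have tauE t : tau t = inv_nneg psi (c * t `^ (q + 1)) by [].
have [kappa [delta [kappa0 kappa1 delta0 tau_le]]] := limf_esup_right_lt1 _ hlim.
have [delta' delta'0 small] := powR_scale_near0 _ _ _ c_ge0 q1_gt0 (psi1_gt0 hpsi hpsi_inc).
have [e e0 eF] := interior_enorm_ball _ _
  (cluster_interior hA sbar_gt run hxbar).
(* Half of [e], so that an iterate within [radius] of [xbar] is closer to [xbar]
   than to any point at distance [e] or more from [xbar]. *)
pose radius := Num.min (e / 2) (Num.min eta (Num.min delta delta')).
have radius0 : 0 < radius by rewrite !lt_min heta delta0 delta'0 divr_gt0.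
have radiusP t : t < radius -> [/\ t < e / 2, t < eta, t < delta & t < delta'].
  by rewrite !lt_min => /and4P.
have Fxbar : F xbar by apply: eF; rewrite subrr enorm0.
have d_le k : enorm (x k - xbar) < radius ->
    enorm (xhat k.+1 - x k) <= ell * rho k.
  move=> /radiusP[xke _ _ _].
  have key z : F z -> Theta z -> enorm (xhat k.+1 - x k) <= ell * enorm (x k - z).
    have /andP[sig _] := run_sigma run k.
    move=> Fz Tz; exact: (step_le_dist hA sbar_gt sig
      (run_sublevel hA sbar_gt run k) (run_xhat run k)
      hell_gt0 hell z Fz Tz).
  rewrite mulrC -ler_pdivrMr //; apply: (le_edist_set _ _ _ _ stat) => z Tz.
  rewrite ler_pdivrMr // mulrC.
  (* A stationary point at distance [e] or more from [xbar] is farther from [x k] than [xbar]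
     is, so it does not affect the bound. *)
  have [ze|ze] := ltP (enorm (z - xbar)) e; first exact: key (eF _ ze) Tz.
  apply: le_trans (key _ Fxbar stat) _; apply: (ler_wpM2l (ltW hell_gt0)).
  have := enorm_triangle (x k) z xbar; rewrite (enormC z (x k)); lra.
have rho_next k : enorm (x k - xbar) < radius ->
    enorm (x k.+1 - xbar) < radius -> rho k.+1 <= tau (rho k).
  move=> xk xk1; have [_ _ _ xkd] := radiusP _ xk; have [_ xk1e _ _] := radiusP _ xk1.
  rewrite tauE; apply: le_inv_nneg => //.
    by apply: small; rewrite rho_ge0 (le_trans (rho_le k)) // ltW.
  apply: le_trans (hreg _ xk1e) _.
  apply: le_trans (run_grad_le hA sbar_gt zeta_range run k) _.
  rewrite cE -[leRHS]mulrA; apply: (ler_wpM2l c1_ge0).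
  rewrite -powRM ?(ltW hell_gt0) //; apply: ge0_ler_powR;
    rewrite ?nnegrE ?enorm_ge0 ?mulr_ge0 ?(ltW hell_gt0) ?(ltW q1_gt0) //.
  exact: d_le.
have short_step k : enorm (x k - xbar) < radius ->
    enorm (x k.+1 - x k) <= (1 + gam) * ell * rho k.
  move=> xk; apply: le_trans
    (run_step_le hA sbar_gt zeta_range run k) _.
  by rewrite -mulrA; apply: ler_wpM2l (d_le k xk); rewrite addr_ge0.
have contraction k : enorm (x k - xbar) < radius ->
    enorm (x k.+1 - xbar) < radius -> rho k.+1 <= kappa * rho k.
  move=> xk xk1; apply: le_trans (rho_next k xk xk1) _.
  have [rho0|rho0] := eqVneq (rho k) 0.
    rewrite rho0 mulr0 tauE powR0 ?gt_eqF // mulr0.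
    by rewrite (inv_nneg0 hpsi).
  apply: tau_le; rewrite lt_def rho0 rho_ge0 /=.
  by apply: le_lt_trans (rho_le k) _; have [] := radiusP _ xk.
have C0 : 0 <= (1 + gam) * ell.
  by rewrite mulr_ge0 ?addr_ge0 // ltW.
have [K rate] := trapped_rate C0 kappa0 kappa1 radius0 hxbar
  rho_ge0 rho_le short_step contraction.
split => //.
  exact: (trapped_cvg C0 kappa0 kappa1 radius0 hxbar
    rho_ge0 rho_le short_step contraction).
pose B := (1 + gam) * ell / (1 - kappa).
have B0 : 0 <= B by rewrite divr_ge0 // subr_ge0 ltW.
apply: (@limn_esup_ratio_lty _ _ _ B K) => // k Kk.
have [xk _] := rate k Kk; have [xk1 rate1] := rate k.+1 (leqW Kk).
have rho_tau : rho k.+1 <= tau (enorm (x k - xbar)).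
  apply: le_trans (rho_next k xk xk1) _; rewrite !tauE; apply: inv_nneg_homo => //.
  - exact: mulr_ge0 c_ge0 (powR_ge0 _ _).
  - apply: (ler_wpM2l c_ge0); apply: ge0_ler_powR;
      by rewrite ?nnegrE ?enorm_ge0 ?(ltW q1_gt0).
  - by apply: small; rewrite enorm_ge0 ltW //; have [] := radiusP _ xk.
split; first exact: enorm_ge0.
  exact: le_trans (rho_ge0 _) rho_tau.
exact: le_trans rate1 (ler_wpM2l B0 rho_tau).
Qed.
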